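(* Let $K$ be a compact metric space and let $f \in DSC(K)\setminus C(K)$. Then $f$ strictly governs the class of separable polyhedral Banach spaces; that is, for every uniformly bounded sequence $(f_n)$ of continuous real functions on $K$ converging pointwise to $f$ on $K$, there exists a convex block sequence $(g_n)$ of $(f_n)$ such that the closed linear span of $(g_n)$ in $C(K)$ (with the supremum norm) is isomorphic to a separable polyhedral Banach space.
   Context: $C(K)$ is the space of continuous real functions on $K$ with the supremum norm. $DSC(K)$ is the set of functions $f:K\to\mathbb{R}$ for which there exists a uniformly bounded sequence $(f_n)\subset C(K)$ with $\lim_n f_n(k)=f(k)$ and $\sum_{n}|f_{n+1}(k)-f_n(k)|<\infty$ for all $k\in K$. A convex block sequence of $(f_n)$ is a sequence $(g_n)$ with $g_n=\sum_{i\in F_n} c_i f_i$, where $F_1<F_2<\cdots$ are finite nonempty sets of positive integers (every element of $F_n$ is less than every element of $F_{n+1}$), $c_i\ge 0$ and $\sum_{i\in F_n}c_i=1$. An infinite dimensional Banach space is polyhedral if the closed unit ball of each of its finite dimensional subspaces has finitely many extreme points. *)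

(* Defs.v *)
From HB Require Import structures.
From mathcomp Require Import all_boot all_order all_algebra.
From mathcomp Require Import all_classical all_reals all_analysis.
Set Implicit Arguments. Unset Strict Implicit. Unset Printing Implicit Defensive.
Import Order.TTheory GRing.Theory Num.Theory.
Import numFieldNormedType.Exports.
Local Open Scope classical_set_scope.
Local Open Scope ring_scope.

Definition supnorm {R : realType} {K : Type} (h : K -> R) : R :=
  sup [set `|h k| | k in [set: K]].

Definition DSC {R : realType} {K : topologicalType} (f : K -> R) : Prop :=
  exists F : nat -> K -> R,
    (forall n, continuous (F n)) /\
    (exists M : R, forall n k, `|F n k| <= M) /\
    (forall k, (fun n => F n k) @ \oo --> f k) /\
    (forall k, cvg (series (fun n => `|F n.+1 k - F n k|) @ \oo)).

Definition convex_block_seq {R : realType} {K : Type}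
    (fs gs : nat -> K -> R) : Prop :=
  exists (B : nat -> seq nat) (c : nat -> R),
    (forall n, B n != [::]) /\
    (forall n, uniq (B n)) /\
    (forall n i j, i \in B n -> j \in B n.+1 -> (i < j)%N) /\
    (forall i, 0 <= c i) /\
    (forall n, \sum_(i <- B n) c i = 1) /\
    (forall n k, gs n k = \sum_(i <- B n) c i * fs i k).

Definition closed_span {R : realType} {K : Type} (gs : nat -> K -> R)
    : set (K -> R) :=
  [set h | forall e : R, 0 < e -> exists (N : nat) (a : 'I_N -> R),
      forall k, `|h k - \sum_(i < N) a i * gs i k| <= e].

Definition lspan {R : realType} {X : normedModType R} (s : seq X) : set X :=
  [set x | exists a : 'I_(size s) -> R, x = \sum_(i < size s) a i *: s`_i].

Definition extreme_point {R : realType} {X : normedModType R}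
    (B : set X) (x : X) : Prop :=
  B x /\ forall y z t, B y -> B z -> 0 < t -> t < 1 ->
    x = t *: y + (1 - t) *: z -> y = z.

Definition infinite_dimensional {R : realType} (X : normedModType R) : Prop :=
  ~ exists s : seq X, lspan s = [set: X].

Definition polyhedral {R : realType} (X : normedModType R) : Prop :=
  infinite_dimensional X /\
  forall s : seq X,
    finite_set (extreme_point [set x | lspan s x /\ `|x| <= 1]).

Definition separable_space {R : realType} (X : normedModType R) : Prop :=
  exists u : nat -> X, closure (range u) = [set: X].

Definition isomorphic_to {R : realType} {K : Type} (S : set (K -> R))
    (X : normedModType R) : Prop :=
  exists T : (K -> R) -> X,
    (forall a x y, S x -> S y ->
        T (fun k => a * x k + y k) = a *: T x + T y) /\
    (forall y : X, exists2 x, S x & T x = y) /\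
    (exists c C : R, 0 < c /\ 0 < C /\
        forall x, S x -> c * supnorm x <= `|T x| /\ `|T x| <= C * supnorm x).

(* Main.v *)
(* Simons' inequality applied to [|fs n - F n|], where [F] witnesses
   [f \in DSC(K)], gives blocks [g n] uniformly close to the same blocks of [F],
   so that [\sum_n |g n.+1 k - g n k|] is finite for every [k].  As [f] is
   discontinuous, a subsequence of [g] has differences [d n] whose coordinates
   are controlled by the norm: [|a n| <= C * ||\sum_i a i d i||].

   Each [k] has a rank [N] with [\sum_(n >= N) |d n k| <= 1/2], so that
   [|x k| <= |x_N k| + (1/2) sup_(n >= N) |a n|], where [x_N] is the partial sum
   [\sum_(n < N) a n d n].  Hence, with [e N = 2^-N] and [b] in a finite net of
   the points of rank [N], the functionals
     [(1 + e N) x_N b]  and  [(1 + e N / 2) x_N b +- a n]  ([n >= N])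
   define an equivalent norm.  All their accumulation points (the
   [(1 + e N / 2) x_N b] and the evaluations at points of [K]) are strictly
   dominated at every nonzero [x], which makes that norm polyhedral. *)
Require Import Defs.
From HB Require Import structures.
From mathcomp Require Import all_boot all_order all_algebra.
From mathcomp Require Import all_classical all_reals all_analysis.
From mathcomp Require Import ring lra.
Set Implicit Arguments. Unset Strict Implicit. Unset Printing Implicit Defensive.
Import Order.TTheory GRing.Theory Num.Theory.
Import numFieldNormedType.Exports.
Local Open Scope classical_set_scope.
Local Open Scope ring_scope.

(** * The closed span of a bounded sequence of functions *)

(** No basis property of [d] is proved, so a vector of the closed span need not be the sum of a
    series in the [d n]. Its coordinates [a n] are limits of coefficients of approximating
    combinations: each function carries its coefficient sequence along on [K + nat], and the closure
    is taken there. The isomorphism onto the renormed space comes from the same device, as a closed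
    graph. The factor [1/2] in the definition of rank pays for the weights. If
    [(1 + e N / 2) |x_N b| + |a n| <= 1] for all [n >= N], then [|x_N b| + (1/2) sup |a n|] stays at
    most 1 even after multiplication by [1 + e N / 2 <= 2]; this surplus, minus the error of the
    net, is what makes evaluations strictly dominated. As [e N] and the tails of [a] tend to 0,
    functionals of large rank exceed the supremum of [|x k|] by arbitrarily little, hence also stay
    strictly below the norm. *)

Definition comb {R : realType} {J : Type} (g : nat -> J -> R) (N : nat)
  (a : nat -> R) (j : J) : R := \sum_(i < N) a i * g i j.

Lemma closed_spanP {R : realType} {J : Type} (g : nat -> J -> R) (h : J -> R) :
  closed_span g h <->
  forall e, 0 < e -> exists N a, forall j, `|h j - comb g N a j| <= e.
Proof.
split=> H e e0.
  have [N [a Ha]] := H e e0.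
  exists N, (fun i => if insub i is Some j then a j else 0) => j.
  rewrite /comb; under eq_bigr do rewrite valK; exact: Ha.
by have [N [a Ha]] := H e e0; exists N, (fun i => a i).
Qed.

Lemma comb_pad {R : realType} {J : Type} (g : nat -> J -> R) N M a :
  (N <= M)%N ->
  comb g N a = comb g M (fun i => if (i < N)%N then a i else 0).
Proof.
move=> NM; apply/funext => j; rewrite /comb.
rewrite (big_ord_widen _ (fun i => a i * g i j) NM) big_mkcond/=.
by apply: eq_bigr => i _; case: ifP => //; rewrite mul0r.
Qed.

Lemma comb_lin {R : realType} {J : Type} (g : nat -> J -> R) N a M b (t : R) :
  exists (P : nat) (c : nat -> R), forall j,
    comb g P c j = t * comb g N a j + comb g M b j.
Proof.
exists (maxn N M), (fun i => t * (if (i < N)%N then a i else 0) +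
  (if (i < M)%N then b i else 0)) => j.
rewrite (comb_pad g a (leq_maxl N M)) (comb_pad g b (leq_maxr N M)).
rewrite /comb mulr_sumr -big_split/=; apply: eq_bigr => i _.
by rewrite mulrDl mulrA.
Qed.

Lemma closed_span_lin {R : realType} {J : Type} (g : nat -> J -> R) t x y :
  closed_span g x -> closed_span g y -> closed_span g (fun j => t * x j + y j).
Proof.
move=> /closed_spanP Hx /closed_spanP Hy; apply/closed_spanP => e e0.
have t1 : 0 < `|t| + 1 by rewrite ltr_wpDl.
have [N [a Ha]] := Hx (e / (`|t| + 1) / 2) ltac:(by rewrite !divr_gt0).
have [M [b Hb]] := Hy (e / 2) ltac:(by rewrite divr_gt0).
have [P [c Pc]] := comb_lin g N a M b t.
exists P, c => j; rewrite Pc.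
have -> : t * x j + y j - (t * comb g N a j + comb g M b j) =
  t * (x j - comb g N a j) + (y j - comb g M b j) by ring.
rewrite (le_trans (ler_normD _ _))// [leRHS](splitr e) lerD// normrM.
have -> : e / 2 = (`|t| + 1) * (e / (`|t| + 1) / 2) by field; rewrite gt_eqF.
by apply: ler_pM => //; rewrite lerDl.
Qed.

Lemma closed_span_gen {R : realType} {J : Type} (g : nat -> J -> R) N a :
  closed_span g (comb g N a).
Proof.
apply/closed_spanP => e e0; exists N, a => j.
by rewrite subrr normr0 ltW.
Qed.

Lemma closed_span_ulim {R : realType} {J : Type} (g : nat -> J -> R) x :
  (forall e, 0 < e -> exists2 y, closed_span g y & forall j, `|x j - y j| <= e) ->
  closed_span g x.
Proof.
move=> H; apply/closed_spanP => e e0.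
have e20 : 0 < e / 2 by rewrite divr_gt0.
have [y /closed_spanP Hy xy] := H _ e20.
have [N [a Ha]] := Hy _ e20; exists N, a => j.
by rewrite (splitr e) (le_trans (ler_distD (y j) _ _))// lerD.
Qed.

Lemma cvgn_distP {R : realType} (u : nat -> R) (l : R) :
  u @ \oo --> l <->
  forall e, 0 < e -> exists N, forall n, (N <= n)%N -> `|u n - l| <= e.
Proof.
split=> [/cvgrPdist_le ul e e0|ul].
  by have [N _ HN] := ul e e0; exists N => n Nn; rewrite distrC; exact: HN.
apply/cvgrPdist_le => e e0; have [N HN] := ul e e0.
by exists N => // n Nn /=; rewrite distrC; exact: HN.
Qed.

(** The rate survives in the limit: [x j - z n j] is split at [z m j], with [m] so large that the
    first part is below any given [e]. *)
Lemma uniform_cauchy_limit {R : realType} {J : Type} (z : nat -> J -> R)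
    (r : nat -> R) :
  r @ \oo --> 0 ->
  (forall n m j, (n <= m)%N -> `|z n j - z m j| <= r n) ->
  exists x : J -> R, forall n j, `|x j - z n j| <= r n.
Proof.
move=> /cvgn_distP r0 zr.
have cz j : cvg ((fun n => z n j) @ \oo).
  apply: cauchy_cvg; apply: cauchy_exP => e e0.
  have [n rn] := r0 (e / 2) ltac:(by rewrite divr_gt0).
  exists (z n j); exists n => // m /= nm; rewrite -ball_normE /=.
  rewrite (le_lt_trans (zr _ _ _ nm))// (le_lt_trans (ler_norm _))//.
  rewrite -[r n]subr0 (le_lt_trans (rn _ (leqnn n)))//.
  by rewrite ltr_pdivrMr// ltr_pMr// ltr1n.
exists (fun j => lim ((fun n => z n j) @ \oo)) => n j.
apply/ler_addgt0Pl => e e0.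
have /cvgn_distP/(_ e e0)[m0 Hm0] := cz j.
have H1 := Hm0 (maxn n m0) (leq_maxr _ _).
rewrite (le_trans (ler_distD (z (maxn n m0) j) _ _))// lerD//.
  by rewrite distrC.
by rewrite distrC zr// leq_maxl.
Qed.

Lemma closed_span_bound {R : realType} {J : Type} (g : nat -> J -> R) h :
  (forall i, exists M, forall j, `|g i j| <= M) -> closed_span g h ->
  exists M, forall j, `|h j| <= M.
Proof.
move=> /choice[B HB] /closed_spanP /(_ 1 ltr01)[N [a Ha]].
exists (1 + \sum_(i < N) `|a i| * B i) => j.
have -> : h j = (h j - comb g N a j) + comb g N a j by rewrite subrK.
rewrite (le_trans (ler_normD _ _))// lerD//.
rewrite (le_trans (ler_norm_sum _ _ _))// ler_sum// => i _.
by rewrite normrM ler_wpM2l.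
Qed.

Lemma supnorm_ub {R : realType} {J : Type} (h : J -> R) M j :
  (forall k, `|h k| <= M) -> `|h j| <= supnorm h.
Proof.
move=> hM; apply: ub_le_sup; last by exists j.
by exists M => _ [k _ <-].
Qed.

Lemma supnorm_le {R : realType} {J : Type} (h : J -> R) e :
  0 <= e -> (forall k, `|h k| <= e) -> supnorm h <= e.
Proof.
move=> e0 he.
have [[j]|noj] := pselect (inhabited J).
  by apply: ge_sup; [exists `|h j|, j|move=> _ [k _ <-]].
(* On an empty [J] the supremum is that of the empty set, 0 by convention; hence the condition
   [0 <= e]. *)
suff -> : supnorm h = 0 by [].
rewrite /supnorm (_ : [set _ | _ in _] = set0) ?sup0//.
by apply/seteqP; split=> // x [k]; case: noj.
Qed.

Lemma supnorm_ge0 {R : realType} {J : Type} (h : J -> R) : 0 <= supnorm h.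
Proof.
rewrite /supnorm; set A := [set _ | _ in _].
have [[[z [k _ zk]] Ab]|/sup_out ->//] := pselect (has_sup A).
by apply: le_trans (normr_ge0 (h k)) (ub_le_sup Ab _); exists k.
Qed.

(* The boundedness clause makes the carrier normable by [supnorm] for every
   family [g], bounded or not. *)
Definition bspan {R : realType} {J : Type} (g : nat -> J -> R) : {pred J -> R} :=
  fun h => `[< closed_span g h /\ exists M, forall j, `|h j| <= M >].

Lemma bspan_submod {R : realType} {J : Type} (g : nat -> J -> R) :
  GRing.submod_closed (bspan g).
Proof.
split.
  apply/asboolP; split; last by exists 0 => j; rewrite normr0.
  have := closed_span_gen g 0 (fun=> 0); rewrite /comb.
  by under [X in closed_span _ X]funext do rewrite big_ord0.
move=> t x y /asboolP[xg [M xM]] /asboolP[yg [M' yM]]; apply/asboolP; split.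
  exact: closed_span_lin.
exists (`|t| * M + M') => j; rewrite (le_trans (ler_normD _ _))// lerD//.
by rewrite normrM ler_wpM2l.
Qed.

HB.instance Definition _ (R : realType) (J : Type) (g : nat -> J -> R) :=
  GRing.isSubmodClosed.Build R (J -> R) (bspan g) (bspan_submod g).

Record spanT (R : realType) (J : Type) (g : nat -> J -> R) := SpanT {
  span_val :> J -> R ; span_valP : span_val \in bspan g }.

HB.instance Definition _ (R : realType) (J : Type) (g : nat -> J -> R) :=
  [isSub for @span_val R J g].
HB.instance Definition _ (R : realType) (J : Type) (g : nat -> J -> R) :=
  [Choice of spanT g by <:].
HB.instance Definition _ (R : realType) (J : Type) (g : nat -> J -> R) :=
  [SubChoice_isSubLmodule of spanT g by <:].

Lemma span_bound {R : realType} {J : Type} {g : nat -> J -> R} (x : spanT g) :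
  exists M, forall j, `|x j| <= M.
Proof. by have /asboolP[] := span_valP x. Qed.

Lemma span_closed {R : realType} {J : Type} {g : nat -> J -> R} (x : spanT g) :
  closed_span g x.
Proof. by have /asboolP[] := span_valP x. Qed.

Lemma span_ub {R : realType} {J : Type} {g : nat -> J -> R} (x : spanT g) j :
  `|x j| <= supnorm x.
Proof. by have [M] := span_bound x; exact: supnorm_ub. Qed.

Lemma span_normD {R : realType} {J : Type} {g : nat -> J -> R} (x y : spanT g) :
  supnorm (x + y) <= supnorm x + supnorm y.
Proof.
apply: supnorm_le => [|j]; first by rewrite addr_ge0 ?supnorm_ge0.
by rewrite (le_trans (ler_normD _ _))// lerD ?span_ub.
Qed.

Lemma span_normZ {R : realType} {J : Type} {g : nat -> J -> R} t (x : spanT g) :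
  supnorm (t *: x) = `|t| * supnorm x.
Proof.
have le s (y : spanT g) : supnorm (s *: y) <= `|s| * supnorm y.
  apply: supnorm_le => [|j]; first by rewrite mulr_ge0 ?supnorm_ge0.
  by rewrite normrM ler_wpM2l ?span_ub.
apply/eqP; rewrite eq_le le andTb.
have [->|t0] := eqVneq t 0; first by rewrite normr0 mul0r; exact: supnorm_ge0.
rewrite -ler_pdivlMl ?normr_gt0// -normfV.
by rewrite -[in leLHS](scalerK t0 x) le.
Qed.

Lemma span_norm0 {R : realType} {J : Type} {g : nat -> J -> R} (x : spanT g) :
  supnorm x = 0 -> x = 0.
Proof.
move=> x0; apply/val_inj/funext => j.
by apply/eqP; rewrite -normr_le0 -x0 span_ub.
Qed.

HB.instance Definition _ (R : realType) (J : Type) (g : nat -> J -> R) :=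
  Lmodule_isNormed.Build R (spanT g) (@span_normD R J g) (@span_normZ R J g)
    (@span_norm0 R J g).

Lemma invS_cvg0 {R : realType} (C e : R) : 0 < e ->
  exists N, forall n, (N <= n)%N -> C / n.+1%:R <= e.
Proof.
move=> e0; exists (Num.truncn (C / e)) => n Nn.
rewrite ler_pdivrMr ?ltr0n// mulrC -ler_pdivrMr//.
have [Ce|Ce] := ltP (C / e) 0; first by rewrite (le_trans (ltW Ce)).
by rewrite ltW// (lt_le_trans (truncnS_gt _))// ler_nat.
Qed.

Lemma half_gt0 {R : realType} (e : R) : 0 < e -> 0 < e / 2.
Proof. by move=> e0; rewrite divr_gt0. Qed.

Lemma half_lt {R : realType} (e : R) : 0 < e -> e / 2 < e.
Proof. by move=> e0; lra. Qed.

(** The filter contains a ball of radius [1/(n+1)] around some [x n]. Any two of these balls meet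
    because the filter is proper, so the centres are uniformly Cauchy, and their uniform limit lies
    in the span. *)
Lemma span_cauchy_cvg {R : realType} {J : Type} (g : nat -> J -> R)
  (F : set_system (spanT g)) : ProperFilter F -> cauchy F -> cvg F.
Proof.
move=> FF /cauchyP Fc.
have /choice[x Fx] n : exists x : spanT g, F (ball x (n.+1%:R^-1 : R)).
  by apply: Fc; rewrite invr_gt0.
have xx n m : (n <= m)%N -> `|x n - x m| <= 2 / n.+1%:R :> R.
  move=> nm; have [y [xny xmy]] := filter_ex (filterI (Fx n) (Fx m)).
  move: xny xmy; rewrite -!ball_normE /= => xny xmy.
  rewrite (le_trans (ler_distD y _ _))// mulr_natl mulr2n lerD ?(ltW xny)//.
  by rewrite distrC (le_trans (ltW xmy))// lef_pV2 ?posrE// ler_nat.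
have [z zP] : exists z : J -> R, forall n j, `|z j - x n j| <= 2 / n.+1%:R.
  apply: uniform_cauchy_limit => [|n m j nm].
    apply/cvgn_distP => e e0; have [N HN] := invS_cvg0 2 e0.
    by exists N => n /HN; rewrite subr0 ger0_norm.
  exact: le_trans (span_ub (x n - x m) j) (xx _ _ nm).
have zg : z \in bspan g.
  apply/asboolP; split.
    apply: closed_span_ulim => e e0; have [N HN] := invS_cvg0 2 e0.
    exists (x N); first exact: span_closed.
    by move=> j; rewrite (le_trans (zP N j))// HN.
  have [M xM] := span_bound (x 0%N); exists (2 / 1 + M) => j.
  rewrite -[z j](subrK (x 0%N j)) (le_trans (ler_normD _ _))//.
  by rewrite lerD//; exact: zP.
pose y := SpanT zg; apply/cvg_ex; exists y => A /nbhs_ballP[e /= e0 yA].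
(* The 3 adds the distance [2/(N+1)] from the limit to the centre [x N] and the radius [1/(N+1)] of
   the ball. *)
have [N HN] := invS_cvg0 3 (half_gt0 e0).
apply: filterS (Fx N) => w; rewrite -ball_normE /= => xw; apply: yA.
rewrite -ball_normE /= (le_lt_trans (ler_distD (x N) _ _))//.
have yx : `|y - x N| <= 2 / N.+1%:R.
  by apply: supnorm_le => // j; exact: zP.
rewrite (le_lt_trans (lerD yx (ltW xw)))//.
have -> : 2 / N.+1%:R + N.+1%:R^-1 = 3 / N.+1%:R :> R by field.
by rewrite (le_lt_trans (HN N _))// half_lt.
Qed.

HB.instance Definition _ (R : realType) (J : Type) (g : nat -> J -> R) :=
  Uniform_isComplete.Build (spanT g) (@span_cauchy_cvg R J g).

Definition spanC (R : realType) (J : Type) (g : nat -> J -> R) :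
  completeNormedModType R := spanT g.

Lemma comb_bspan {R : realType} {J : Type} (g : nat -> J -> R) N a :
  (forall i, exists M, forall j, `|g i j| <= M) -> comb g N a \in bspan g.
Proof.
move=> gb; have cl := closed_span_gen g N a.
by apply/asboolP; split=> //; exact: closed_span_bound cl.
Qed.

Lemma span_separable {R : realType} {J : Type} (g : nat -> J -> R) :
  (forall i, exists M, forall j, `|g i j| <= M) ->
  separable_space (spanT g : normedModType R).
Proof.
move=> gb.
pose v n : seq rat := odflt [::] (unpickle n).
pose u n : spanT g := SpanT (comb_bspan (size (v n)) (fun i => ratr (v n)`_i) gb).
have uE s j : u (pickle s) j = comb g (size s) (fun i => ratr s`_i) j.
  by rewrite -[LHS]/(comb g (size (v _)) _ j) /v pickleK.
exists u; apply/seteqP; split=> // x _ A /nbhs_ballP[e /= e0 xA].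
have /closed_spanP/(_ _ (half_gt0 (half_gt0 e0)))[N [a xa]] := span_closed x.
have /choice[B gB] := gb.
pose S : R := 1 + \sum_(i < N) `|B i|.
(* [S] bounds the sum of the sup norms of the generators in use, so changing every coefficient by at
   most [d] moves the combination by at most [d * S = e / 4]. *)
have S0 : 0 < S by rewrite ltr_pwDl// sumr_ge0.
pose d := e / 2 / 2 / S; have d0 : 0 < d by rewrite !divr_gt0.
have /choice[q qa] (i : nat) : exists q : rat, `|a i - ratr q| <= d.
  have [|q] := @rat_in_itvoo R (a i - d) (a i + d).
    by rewrite ltrD2l gtrN.
  rewrite in_itv/= => /andP[q1 q2]; exists q.
  by rewrite ler_norml; apply/andP; split; lra.
exists (u (pickle [seq q i | i <- iota 0 N])); split; first by eexists.
apply: xA; rewrite -ball_normE /=.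
apply: (@le_lt_trans _ _ (e / 2)); last by rewrite half_lt.
apply: supnorm_le; first by rewrite ltW// divr_gt0.
move=> j; rewrite -[X in `|X|]/(x j - u (pickle [seq q i | i <- iota 0 N]) j) uE size_map size_iota.
rewrite (le_trans (ler_distD (comb g N a j) _ _))// [leRHS]splitr lerD//.
rewrite /comb -sumrB.
have -> : e / 2 / 2 = d * S by rewrite /d divfK// gt_eqF.
rewrite (le_trans (ler_norm_sum _ _ _))//.
rewrite (@le_trans _ _ (d * \sum_(i < N) `|B i|))//; last first.
  by rewrite ler_pM2l// lerDr.
rewrite mulr_sumr ler_sum// => i _.
rewrite (nth_map 0%N) ?size_iota// nth_iota// add0n -mulrBl normrM ler_pM//.
by rewrite (le_trans (gB i j))// ler_norm.
Qed.

(** The closed span of the functions [joinf (g n) (y n)] is the closed graph of the correspondence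
    [comb g N a] to [comb y N a]. Linearity in both variables and symmetry of the graph come for
    free. *)
Definition joinf {R : Type} {K J : Type} (h : K -> R) (x : J -> R) (s : K + J)
  : R := match s with inl k => h k | inr j => x j end.

Definition comb_dom {R : realType} {K J : Type} (C : R) (g : nat -> K -> R)
    (y : nat -> J -> R) : Prop :=
  forall N a e, (forall k, `|comb g N a k| <= e) ->
    forall j, `|comb y N a j| <= C * e.

Lemma closed_span_comp {R : realType} {K J : Type} (g : nat -> K -> R)
    (f : J -> K) h :
  closed_span g h -> closed_span (fun n j => g n (f j)) (fun j => h (f j)).
Proof.
move=> /closed_spanP H; apply/closed_spanP => e /H[N [a Ha]].
by exists N, a => j; exact: Ha.
Qed.

Lemma closed_span_joinf {R : realType} {K J : Type} (g : nat -> K -> R)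
    (y : nat -> J -> R) h x :
  closed_span (fun n => joinf (g n) (y n)) (joinf h x) <->
  forall e, 0 < e -> exists N a, (forall k, `|h k - comb g N a k| <= e) /\
                                 (forall j, `|x j - comb y N a j| <= e).
Proof.
split=> [/closed_spanP H e /H[N [a Ha]]|H].
  exists N, a; split=> [k|j]; [exact: (Ha (inl k))|exact: (Ha (inr j))].
by apply/closed_spanP => e /H[N [a [H1 H2]]]; exists N, a => -[k|j]//=.
Qed.

(** The graph projects onto the whole closed span of [g]: approximants of [h] at precision [1/(n+1)]
    have, by domination, uniformly Cauchy counterparts, and these converge to the required [x]. *)
Lemma joinf_ex {R : realType} {K J : Type} (C : R) (g : nat -> K -> R)
    (y : nat -> J -> R) h :
  0 < C -> comb_dom C g y -> closed_span g h ->
  exists x, closed_span (fun n => joinf (g n) (y n)) (joinf h x).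
Proof.
move=> C0 gy /closed_spanP hg.
have /choice[N /choice[a Na]] (n : nat) : exists N a, forall k,
    `|h k - comb g N a k| <= n.+1%:R^-1 by apply: hg; rewrite invr_gt0.
have [x xP] : exists x : J -> R, forall n j,
    `|x j - comb y (N n) (a n) j| <= C * (2 / n.+1%:R).
  apply: uniform_cauchy_limit => [|n m j nm].
    apply/cvgn_distP => e e0; have [P HP] := invS_cvg0 (C * 2) e0.
    by exists P => n /HP; rewrite subr0 -mulrA ger0_norm// mulr_ge0// ltW.
  have [P [c Pc]] := comb_lin (fun n => joinf (g n) (y n))
    (N m) (a m) (N n) (a n) (-1).
  have -> : comb y (N n) (a n) j - comb y (N m) (a m) j = comb y P c j.
    rewrite [RHS](_ : _ = -1 * comb y (N m) (a m) j + comb y (N n) (a n) j).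
      by rewrite mulN1r addrC.
    exact: (Pc (inr j)).
  apply: gy => k.
  rewrite (_ : comb g P c k = -1 * comb g (N m) (a m) k + comb g (N n) (a n) k).
    rewrite mulN1r addrC.
    rewrite (le_trans (ler_distD (h k) _ _))// mulr_natl mulr2n.
    rewrite lerD//; first by rewrite distrC.
    by rewrite (le_trans (Na m k))// lef_pV2 ?posrE// ler_nat.
  exact: (Pc (inl k)).
exists x; apply/closed_span_joinf => e e0.
have [n1 Hn1] := invS_cvg0 (C * 2) e0; have [n2 Hn2] := invS_cvg0 1 e0.
exists (N (maxn n1 n2)), (a (maxn n1 n2)); split=> [k|j].
  by rewrite (le_trans (Na _ _))// -div1r Hn2// leq_maxr.
by rewrite (le_trans (xP _ _))// mulrA Hn1// leq_maxl.
Qed.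

Lemma joinf_dom {R : realType} {K J : Type} (C : R) (g : nat -> K -> R)
    (y : nat -> J -> R) h x e :
  0 < C -> comb_dom C g y ->
  closed_span (fun n => joinf (g n) (y n)) (joinf h x) ->
  (forall k, `|h k| <= e) -> forall j, `|x j| <= C * e.
Proof.
move=> C0 gy /closed_span_joinf hx he j; apply/ler_addgt0Pl => d d0.
(* Chosen so that [d' + C * (e + d') = d + C * e]: one [d'] for approximating [x], one for
   approximating [h]. *)
pose d' := d / (C + 1); have C1 : 0 < C + 1 by rewrite addr_gt0.
have d'0 : 0 < d' by rewrite divr_gt0.
have [N [a [Ha Hx]]] := hx d' d'0.
have -> : d + C * e = d' + C * (e + d').
  by rewrite /d'; field; rewrite gt_eqF.
rewrite -[x j](subrK (comb y N a j)) (le_trans (ler_normD _ _))// lerD//.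
apply: gy => k; rewrite -[comb g N a k](subrK (h k)).
by rewrite (le_trans (ler_normD _ _))// addrC lerD// distrC.
Qed.

(** The graph relation [P] is total by [joinf_ex] and single-valued by [joinf_dom] at [e = 0].
    Exchanging [K] and [J] gives surjectivity and the lower bound, with constant [D^-1]. *)
Lemma comb_dom_isomorphic {R : realType} {K J : Type} (C D : R)
    (g : nat -> K -> R) (y : nat -> J -> R) :
  0 < C -> 0 < D -> comb_dom C g y -> comb_dom D y g ->
  (forall i, exists M, forall k, `|g i k| <= M) ->
  (forall i, exists M, forall j, `|y i j| <= M) ->
  isomorphic_to (closed_span g) (spanT y : normedModType R).
Proof.
move=> C0 D0 gy yg gb yb.
pose P h (x : spanT y) := closed_span (fun n => joinf (g n) (y n)) (joinf h x).
have Pe h : closed_span g h -> exists x, P h x.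
  move=> /(joinf_ex C0 gy)[x hx].
  have xy : x \in bspan y.
    have cl : closed_span y x := closed_span_comp (fun j => inr j) hx.
    by apply/asboolP; split=> //; exact: closed_span_bound cl.
  by exists (SpanT xy).
have Plin t h1 x1 h2 x2 : P h1 x1 -> P h2 x2 ->
    P (fun k => t * h1 k + h2 k) (t *: x1 + x2).
  move=> P1 P2; have := closed_span_lin t P1 P2.
  rewrite /P; congr (closed_span _ _); apply/funext; by case.
have swap h x : closed_span (fun n => joinf (y n) (g n)) (joinf x h) ->
    closed_span (fun n => joinf (g n) (y n)) (joinf h x).
  move=> hx.
  have := closed_span_comp
    (fun s : K + J => match s with inl k => inr k | inr j => inl j end) hx.
  congr (closed_span _ _); last by apply/funext; case.
  by apply/funext => n; apply/funext; case.
have swap' h x : closed_span (fun n => joinf (g n) (y n)) (joinf h x) ->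
    closed_span (fun n => joinf (y n) (g n)) (joinf x h).
  move=> hx.
  have := closed_span_comp
    (fun s : J + K => match s with inl k => inr k | inr j => inl j end) hx.
  congr (closed_span _ _); last by apply/funext; case.
  by apply/funext => n; apply/funext; case.
have Puniq h x1 x2 : P h x1 -> P h x2 -> x1 = x2.
  move=> P1 P2; have := Plin (-1) _ _ _ _ P1 P2 => P12.
  have H : forall j, `|(-1 *: x1 + x2) j| <= C * 0.
    apply: (joinf_dom C0 gy P12) => k.
    by rewrite mulN1r addrC subrr normr0.
  apply/val_inj/funext => j; have := H j; rewrite mulr0 normr_le0.
  by rewrite /= -[(_ + _) j]/(-1 * x1 j + x2 j) mulN1r addrC subr_eq0 => /eqP.
(* The default 0 is taken only where [h] has no image, thus off the closed span, where
   [isomorphic_to] demands nothing. *)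
pose T h := xget (0 : spanT y) (P h).
have TP h : closed_span g h -> P h (T h).
  by move=> /Pe[x hx]; exact: (xgetI _ hx).
exists T; split=> [t h1 h2 H1 H2|].
  apply: Puniq (TP _ (closed_span_lin t H1 H2)) _.
  exact: Plin (TP _ H1) (TP _ H2).
split=> [x|].
  have [h hx] := joinf_ex D0 yg (span_closed x).
  have gh : closed_span g h := closed_span_comp (fun j => inr j) hx.
  by exists h => //; apply: Puniq (TP _ gh) _; exact: swap.
exists (D^-1), C; rewrite invr_gt0; do 2!split=> //.
move=> h gh; have [M hM] := closed_span_bound gb gh; split.
  rewrite mulrC ler_pdivrMr// mulrC.
  apply: supnorm_le; first by rewrite mulr_ge0 ?(ltW D0).
  apply: (joinf_dom D0 yg (swap' _ _ (TP _ gh))) => j; exact: span_ub.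
apply: supnorm_le; first by rewrite mulr_ge0 ?(ltW C0)// supnorm_ge0.
apply: (joinf_dom C0 gy (TP _ gh)) => k; exact: supnorm_ub hM.
Qed.

(** * A criterion for polyhedrality *)

Lemma lspan_cons {R : realType} {X : normedModType R} (y : X) s x :
  lspan (y :: s) x <-> exists t z, lspan s z /\ x = t *: y + z.
Proof.
split=> [[a ->]|[t [z [[a ->] ->]]]].
  rewrite /= big_ord_recl /=; exists (a ord0), (\sum_(i < size s) a (lift ord0 i) *: s`_i).
  by split=> //; exists (fun i => a (lift ord0 i)).
exists (fun i => oapp a t (unlift ord0 i)).
rewrite /= big_ord_recl unlift_none /=; congr (_ + _).
by apply: eq_bigr => i _; rewrite liftK.
Qed.

Lemma lspan_lin {R : realType} {X : normedModType R} (s : seq X) t x y :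
  lspan s x -> lspan s y -> lspan s (t *: x + y).
Proof.
move=> [a ->] [b ->]; exists (fun i => t * a i + b i).
rewrite scaler_sumr -big_split; apply: eq_bigr => i _ /=.
by rewrite scalerDl scalerA.
Qed.

Lemma lspan0 {R : realType} {X : normedModType R} (s : seq X) : lspan s 0.
Proof. by exists (fun=> 0); rewrite big1// => i _; rewrite scale0r. Qed.

Lemma normed_compact_closed {R : realType} {X : normedModType R} (A : set X) :
  compact A -> closed A.
Proof. by apply: compact_closed; exact: norm_hausdorff. Qed.

Lemma lspan_dist {R : realType} {X : normedModType R} (s : seq X) y :
  (forall r, compact [set x | lspan s x /\ `|x| <= r]) -> ~ lspan s y ->
  exists2 d : R, 0 < d & forall z, lspan s z -> d <= `|y - z|.
Proof.
move=> cs ny; have := normed_compact_closed (cs (`|y| + 1)).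
move=> /closed_openC oA.
have : nbhs y (~` [set x | lspan s x /\ `|x| <= `|y| + 1]).
  by apply: open_nbhs_nbhs; split=> // -[].
move=> /nbhs_ballP[e /= e0 yA].
(* The 1 confines [z] to the ball of radius [|y| + 1], whose trace on the span is known to be
   closed. *)
exists (Order.min e 1); first by rewrite lt_min e0 ltr01.
move=> z sz; rewrite leNgt lt_min; apply/negP => /andP[yze yz1].
apply: (yA z); first by rewrite -ball_normE.
split=> //; rewrite -lerBlDl (le_trans (lerB_dist _ _))// distrC.
exact: ltW.
Qed.

(** Induction on [s]. A new vector [y] outside the span has a distance [d > 0] from it, which bounds
    the coefficient of [y] by [r / d] and then the remaining part. The ball is therefore a closed
    subset of a continuous image of an interval times a smaller ball. *)
Lemma lspan_ball_compact {R : realType} {X : normedModType R} (s : seq X) r :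
  compact [set x | lspan s x /\ `|x| <= r].
Proof.
elim: s r => [|y s IH] r.
  apply: (@subclosed_compact _ _ [set 0]); last 2 first.
  - exact: compact_set1.
  - by move=> x [[a ->] _] /=; rewrite big_ord0.
  have [r0|r0] := leP 0 r.
    rewrite (_ : [set _ | _] = [set 0]).
      by apply: normed_compact_closed; exact: compact_set1.
    apply/seteqP; split=> [x [[a ->] _]|x ->] /=; first by rewrite big_ord0.
    by split; [exact: lspan0|rewrite normr0].
  rewrite (_ : [set _ | _] = set0); first exact: closed0.
  apply/seteqP; split=> // x [_]; rewrite leNgt => /negP; apply.
  exact: lt_le_trans r0 _.
have [ys|ny] := pselect (lspan s y).
  rewrite (_ : [set _ | _] = [set x | lspan s x /\ `|x| <= r]) //.
  apply/seteqP; split=> x [sx xr]; split=> //.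
    by move/lspan_cons: sx => [t [z [sz ->]]]; exact: lspan_lin.
  by apply/lspan_cons; exists 0, x; rewrite scale0r add0r.
have [d d0 yd] := lspan_dist IH ny.
pose A := `[- (r / d), r / d]%classic `*`
  [set x | lspan s x /\ `|x| <= r + r / d * `|y|].
pose f (tz : R * X) := tz.1 *: y + tz.2.
have cA : compact A by apply: compact_setX (IH _); exact: segment_compact.
have cf : continuous f.
  move=> tz; apply: cvgD; last exact: cvg_snd.
  by apply: cvgZ; [exact: cvg_fst|exact: cvg_cst].
have cI : compact (f @` A).
  by apply: continuous_compact cA; exact: continuous_subspaceT.
have cB : closed [set x : X | `|x| <= r].
  rewrite (_ : [set _ | _] = (fun x : X => `|x|) @^-1` [set t | t <= r])//.
  by apply: closed_comp (@closed_le _ _) => x _; exact: norm_continuous.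
rewrite (_ : [set _ | _] = (f @` A) `&` [set x | `|x| <= r]).
  apply: (subclosed_compact _ cI); last by move=> x [].
  by apply: closedI => //; exact: normed_compact_closed.
apply/seteqP; split=> [x [sx xr]|x [[[t z] [/= tr [sz _]] <-] xr]]; last first.
  by split=> //; apply/lspan_cons; exists t, z.
split=> //; move/lspan_cons: sx => [t [z [sz xE]]].
have td : `|t| <= r / d.
  rewrite ler_pdivlMr//; apply: le_trans xr; rewrite xE.
  have [->|t0] := eqVneq t 0; first by rewrite normr0 mul0r.
  have -> : t *: y + z = t *: (y - (- t^-1) *: z).
    by rewrite scaleNr opprK scalerDr scalerA divff// scale1r.
  rewrite normrZ ler_wpM2l// yd//.
  by rewrite -[_ *: z]addr0; apply: lspan_lin => //; exact: lspan0.
exists (t, z) => //; split=> /=; first by rewrite in_itv/= -ler_norml.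
split=> //; have -> : z = x - t *: y by rewrite xE addrC addKr.
rewrite (le_trans (ler_normB _ _))// lerD// normrZ ler_wpM2r//.
Qed.

(** If [m] vectors spanned the space, the coefficients of the first [m + 1] generators would form a
    matrix with more rows than columns; a nonzero vector of its left kernel is a relation between
    free generators. *)
Lemma lspan_proper {R : realType} {J : Type} (g : nat -> J -> R) :
  (forall i, exists M, forall j, `|g i j| <= M) ->
  (forall N a, (forall j, comb g N a j = 0) ->
     forall i, (i < N)%N -> a i = 0) ->
  infinite_dimensional (spanT g : normedModType R).
Proof.
move=> gb gfree [s sT]; pose m := size s.
pose y i : spanT g := SpanT (comb_bspan i.+1 (fun j => (j == i)%:R) gb).
have yE i j : y i j = g i j.
  rewrite -[LHS]/(comb g _ _ j) /comb big_ord_recr/= eqxx mul1r big1 ?add0r//.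
  by move=> k _ /=; rewrite (ltn_eqF (ltn_ord k)) mul0r.
have /choice[A yA] (i : nat) : lspan s (y i) by rewrite sT.
pose M : 'M[R]_(m.+1, m) := \matrix_(i, j) A i j.
have : kermx M != 0.
  rewrite kermx_eq0 /row_free; apply/negP => /eqP rM.
  by have := rank_leq_col M; rewrite rM ltnn.
move=> /rowV0Pn[v /sub_kermxP vM v0]; case/negP: v0; apply/eqP/rowP => i.
rewrite mxE -[i in LHS]inord_val.
apply: (gfree m.+1 (fun k => v 0 (inord k))) => // j.
pose z : spanT g := \sum_(k < m.+1) v 0 k *: y k.
have z0 : z = 0.
  rewrite /z; under eq_bigr do rewrite yA scaler_sumr.
  rewrite exchange_big big1//= => k _.
  under eq_bigr do rewrite scalerA.
  rewrite -scaler_suml.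
  move/rowP: vM => /(_ k); rewrite !mxE.
  by under eq_bigr do rewrite !mxE; move=> ->; rewrite scale0r.
have zE : z j = \sum_(k < m.+1) v 0 k * y k j.
  rewrite /z; elim/big_rec2: _ => // k u w _ <-.
  by [].
transitivity (z j); last by rewrite z0.
by rewrite zE; apply: eq_bigr => k _; rewrite inord_val yE.
Qed.

Lemma seq_pos_lb {R : realType} {J : eqType} (s : seq J) (P : J -> R) :
  (forall j, j \in s -> 0 < P j) ->
  exists2 e, 0 < e & forall j, j \in s -> e <= P j.
Proof.
elim: s => [|i s IH] Ps; first by exists 1.
have [|e e0 He] := IH; first by move=> j js; apply: Ps; rewrite inE js orbT.
exists (Order.min e (P i)).
  by rewrite lt_min e0 Ps// inE eqxx.
by move=> j; rewrite inE => /orP[/eqP ->|/He je]; rewrite ge_min ?je ?lexx ?orbT.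
Qed.

(* Near a nonzero [x] only finitely many coordinates matter for the norm; by
   compactness of its unit sphere, the norm of a finite dimensional subspace is
   then a maximum of finitely many functionals. *)
Definition coord_gap {R : realType} {J : choiceType} (g : nat -> J -> R) :=
  forall x : spanT g, x != 0 ->
    exists (F : seq J) (d : R), 0 < d /\
      forall j, j \notin F -> `|x j| <= `|x| - d.

(** Otherwise the finitely many coordinates in [F] would also miss the norm by a common positive
    amount, and the supremum would be smaller than the norm. *)
Lemma coord_gap_attained {R : realType} {J : choiceType} (g : nat -> J -> R) :
  coord_gap g -> forall x : spanT g, x != 0 -> exists j, `|x j| = `|x|.
Proof.
move=> gap x x0; have [F [d [d0 Hd]]] := gap x x0.
apply: contrapT => nex.
have lt j : 0 < `|x| - `|x j|.
  rewrite subr_gt0 lt_neqAle span_ub andbT; apply/eqP => xj.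
  by apply: nex; exists j.
have [e e0 He] := seq_pos_lb (fun j (_ : j \in F) => lt j).
have : `|x| <= Order.max 0 (`|x| - Order.min e d).
  apply: supnorm_le => [|j]; first by rewrite le_max lexx.
  rewrite le_max; apply/orP; right; rewrite lerBrDr -lerBrDl.
  have [/He je|/Hd jd] := boolP (j \in F); rewrite ge_min ?je//.
  by apply/orP; right; rewrite lerBrDl -lerBrDr.
rewrite le_max => /orP[|].
  by rewrite normr_le0 (negbTE x0).
by rewrite lerBrDr gerDl leNgt lt_min e0 d0.
Qed.

(** Finitely many balls [ball y (d y)] cover the unit sphere of the span. If a unit vector [u] lies
    in the ball of [y] and [|u j| = 1], then [j] is in [F y], since outside [F y] the coordinate of
    [y] is at most [1 - d y]. So the lists [F y] of these centres detect the norm. *)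
Lemma coord_gap_lspan {R : realType} {J : choiceType} (g : nat -> J -> R)
    (s : seq (spanT g)) :
  coord_gap g -> exists F : seq J, forall x, lspan s x ->
    (forall j, j \in F -> `|x j| <= 1) -> `|x| <= 1.
Proof.
move=> gap.
pose S := [set x : spanT g | lspan s x /\ `|x| = 1].
have cS : compact S.
  apply: subclosed_compact (lspan_ball_compact (s := s) (r := 1)) _; last first.
    by move=> x [sx x1]; split=> //; rewrite x1.
  rewrite (_ : S = [set x | lspan s x /\ `|x| <= 1] `&`
                   (fun x : spanT g => `|x|) @^-1` [set t | 1 <= t]).
    apply: closedI; first exact: normed_compact_closed
      (@lspan_ball_compact _ _ s 1).
    by apply: closed_comp (@closed_ge _ _) => x _; exact: norm_continuous.
  apply/seteqP; split=> [x [sx x1]|x [[sx x1] /= x1']].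
    by rewrite /= x1.
  by split=> //; apply/eqP; rewrite eq_le x1.
have /choice[F /choice[d Fd]] (x : spanT g) : exists F d, 0 < d /\
    (x != 0 -> forall j, j \notin (F : seq J) -> `|x j| <= `|x| - d).
  have [->|/gap[F [d [d0 H]]]] := eqVneq x 0; first by exists [::], 1.
  by exists F, d.
move: cS; rewrite compact_cover => /(_ (spanT g) S (fun x => ball x (d x))).
case=> [x _|x Sx|D DS SD].
- exact: ball_open.
- by exists x => //; apply: ballxx; case: (Fd x).
exists (flatten [seq F x | x <- finmap.enum_fset D]) => x sx Hx.
rewrite leNgt; apply/negP => x1.
have x0 : x != 0 by rewrite -normr_gt0 (lt_trans ltr01).
pose u := `|x|^-1 *: x.
have u1 : `|u| = 1 by rewrite normfZV.
have u0 : u != 0 by rewrite -normr_gt0 u1.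
have [j] := coord_gap_attained gap u0; rewrite u1 => uj.
have [|y /= yD yu] := SD u.
  by split=> //; rewrite -[u]addr0; apply: lspan_lin => //; exact: lspan0.
have [[sy y1] [d0 yF]] := (set_mem (DS y yD), Fd y).
have jF : j \in F y.
  apply/negPn/negP => jF; move: yu; rewrite -ball_normE /= ltNge => /negP; apply.
  have := yF _ _ jF; rewrite -normr_gt0 y1 => /(_ ltr01) yj.
  apply: le_trans (span_ub (y - u) j).
  rewrite -[(y - u) j]/(y j - u j) distrC.
  by apply: le_trans (lerB_dist _ _); rewrite uj lerBrDl -lerBrDr.
have := Hx j; rewrite leNgt (_ : `|x j| = `|x|).
  rewrite x1 /= => /(_ _); suff -> : j \in flatten [seq F x | x <- finmap.enum_fset D].
    by move=> /(_ isT).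
  by apply/flatten_mapP; exists y.
have -> : x j = `|x| * u j by rewrite -[u j]/(`|x|^-1 * x j) mulrA divff ?mul1r// normr_eq0.
by rewrite normrM uj mulr1 normr_id.
Qed.

(** An extreme point is determined by which coordinates in [F] equal 1 and which equal -1. If [x]
    and [y] share this pattern, then [z = x + t (x - y)] is still in the ball for small [t > 0], and
    [x] lies strictly between [z] and [y]; so [z = y] and [x = y]. *)
Lemma coord_gap_polyhedral {R : realType} {J : choiceType} (g : nat -> J -> R)
    (s : seq (spanT g : normedModType R)) :
  coord_gap g ->
  finite_set (extreme_point [set x | lspan s x /\ `|x| <= 1]).
Proof.
move=> gap; have [F FP] := coord_gap_lspan s gap.
set E := extreme_point _.
pose pat (x : spanT g) : {ffun 'I_(size F) -> bool * bool} :=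
  [ffun i => let j := tnth (in_tuple F) i in (x j == 1, x j == -1)].
have pat_inj x y : E x -> E y -> pat x = pat y -> x = y.
  move=> [[sx x1] xE] [[sy y1] _] xy.
  have xy1 j : j \in F -> `|x j| = 1 -> x j = y j.
    move=> /(tnthP (in_tuple F))[i ->] /eqP; rewrite eqr_norml ler01 andbT.
    move/ffunP: xy => /(_ i); rewrite !ffunE => -[e1 e2].
    move=> /orP[x1'|x1'].
      by move: e1; rewrite x1' (eqP x1') => /esym/eqP.
    by move: e2; rewrite x1' (eqP x1') => /esym/eqP.
  (* Since [|x j - y j| <= 2], half of the slack [1 - |x j|] is a safe step. At saturated
     coordinates [x j = y j], so any step is harmless and 1 is a placeholder. *)
  have [t t0 Ht] : exists2 t : R, 0 < t & forall j, j \in F ->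
      t <= (if `|x j| < 1 then (1 - `|x j|) / 2 else 1).
    apply: seq_pos_lb => j _; case: ifPn => // xj.
    by rewrite divr_gt0// subr_gt0.
  pose z := t *: (x - y) + x.
  have sz : lspan s z.
    apply: (lspan_lin _ _ sx); rewrite addrC -scaleN1r; exact: lspan_lin.
  have z1 : `|z| <= 1.
    apply: FP => // j jF; rewrite -[z j]/(t * (x j - y j) + x j).
    have [xj|xj] := ltP `|x j| 1; last first.
      have xj1 : `|x j| = 1.
        by apply/eqP; rewrite eq_le xj andbT (le_trans (span_ub x j)).
      by rewrite -xy1// subrr mulr0 add0r xj1.
    have := Ht j jF; rewrite xj => tj.
    rewrite (le_trans (ler_normD _ _))// normrM gtr0_norm//.
    have xyj : `|x j - y j| <= 2.
      rewrite (le_trans (ler_normB _ _))// mulr2n lerD//.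
        exact: le_trans (span_ub x j) x1.
      exact: le_trans (span_ub y j) y1.
    have : t * `|x j - y j| <= (1 - `|x j|) / 2 * 2.
      by apply: ler_pM => //; exact: ltW.
    by rewrite divfK// lerBrDr.
  have t1 : 0 < 1 + t by rewrite addr_gt0.
  have zy : z = y.
    apply: (xE z y (1 + t)^-1) => //.
    - by rewrite invr_gt0.
    - by rewrite invf_lt1// ltrDl.
    have -> : z = (1 + t) *: x - t *: y.
      by rewrite /z scalerBr scalerDl scale1r addrC addrA.
    have -> : 1 - (1 + t)^-1 = (1 + t)^-1 * t by field; rewrite gt_eqF.
    by rewrite scalerBr !scalerA mulVf ?gt_eqF// scale1r subrK.
  have : (1 + t) *: (x - y) = 0.
    by rewrite scalerDl scale1r addrC addrA -/z zy subrr.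
  move/eqP; rewrite scaler_eq0 gt_eqF//= subr_eq0 => /eqP//.
apply: (@sub_finite_set _ _ ((fun p => xget 0 [set x | E x /\ pat x = p]) @` setT)).
  move=> x Ex; exists (pat x) => //.
  have [Ey yx] := xgetI 0 (conj Ex (erefl (pat x)) : [set y | E y /\ pat y = pat x] x).
  exact: pat_inj.
by apply: finite_image; exact: finite_finset.
Qed.

(** * Convex combinations of pointwise null sequences *)

Lemma near_min {R : realType} {T : Type} (P : T -> Prop) (Q : T -> R) d :
  0 < d -> (exists x, P x) -> (forall x, 0 <= Q x) ->
  exists y, P y /\ forall x, P x -> Q y <= Q x + d.
Proof.
move=> d0 [x0 Px0] Q0.
have hi : has_inf [set Q x | x in [set x | P x]].
  by split; [exists (Q x0), x0|exists 0 => _ [x _ <-]].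
have [_ [y Py <-] Qy] := inf_adherent d0 hi.
exists y; split=> // x Px; rewrite (le_trans (ltW Qy))// lerD2r.
by apply: (ge_inf hi.2); exists x.
Qed.

Lemma ulim_continuous {R : realType} {K : topologicalType} (v : K -> R) :
  (forall e, 0 < e -> exists2 u, continuous u & forall k, `|v k - u k| <= e) ->
  continuous v.
Proof.
move=> H x; apply/cvgrPdist_le => e e0.
have [u uc vu] := H (e / 3) ltac:(by rewrite divr_gt0).
have /cvgrPdist_le/(_ (e / 3)) := uc x.
move=> /(_ ltac:(by rewrite divr_gt0)); apply: filterS => y /= uxy.
have -> : v x - v y = (v x - u x) + (u x - u y) - (v y - u y) by ring.
rewrite (le_trans (ler_normB _ _))//.
have -> : e = e / 3 + e / 3 + e / 3 by field.
by rewrite lerD// (le_trans (ler_normD _ _))// lerD.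
Qed.

Lemma compact_max {R : realType} {K : topologicalType} (v : K -> R) (k : K) :
  compact [set: K] -> continuous v -> exists b, forall t, v t <= v b.
Proof.
move=> cK vc; have [||b _ bm] := compact_EVT_max _ cK (f := v).
- by exists k.
- exact: continuous_subspaceT.
by exists b => t; apply: bm; rewrite inE.
Qed.

(** Midpoints are enough for Simons' argument: its weights [1/2^j] arise by repeated halving, and
    every property of these combinations follows by induction. *)
Inductive dyadic_conv {R : realType} {K : Type} (h : nat -> K -> R) (n : nat) :
    (K -> R) -> Prop :=
| dyadic_gen p : (n <= p)%N -> dyadic_conv h n (h p)
| dyadic_mid u v : dyadic_conv h n u -> dyadic_conv h n v ->
    dyadic_conv h n (fun k => (u k + v k) / 2).

Lemma dyadic_conv_mono {R : realType} {K : Type} (h : nat -> K -> R) n m u :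
  (n <= m)%N -> dyadic_conv h m u -> dyadic_conv h n u.
Proof.
move=> nm; elim=> [p mp|u1 u2 _ H1 _ H2]; last exact: dyadic_mid.
by apply: dyadic_gen; exact: leq_trans mp.
Qed.

Lemma dyadic_conv_le {R : realType} {K : Type} (h : nat -> K -> R) n u k e :
  (forall p, (n <= p)%N -> h p k <= e) -> dyadic_conv h n u -> u k <= e.
Proof. by move=> he; elim=> [p /he//|u1 u2 _ H1 _ H2]; lra. Qed.

Lemma dyadic_conv_ge0 {R : realType} {K : Type} (h : nat -> K -> R) n u k :
  (forall p, 0 <= h p k) -> dyadic_conv h n u -> 0 <= u k.
Proof. by move=> h0; elim=> // u1 u2 _ H1 _ H2; lra. Qed.

Lemma dyadic_conv_continuous {R : realType} {K : topologicalType}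
    (h : nat -> K -> R) n u :
  (forall p, continuous (h p)) -> dyadic_conv h n u -> continuous u.
Proof.
move=> hc; elim=> // u1 u2 _ H1 _ H2 x.
by apply: cvgM; [apply: cvgD; [exact: H1|exact: H2]|exact: cvg_cst].
Qed.

Lemma dyadic_convE {R : realType} {K : Type} (h : nat -> K -> R) n u :
  dyadic_conv h n u -> exists (c : nat -> R) N, (forall i, 0 <= c i) /\
    forall m, (N <= m)%N -> \sum_(n <= i < m) c i = 1 /\
      forall k, u k = \sum_(n <= i < m) c i * h i k.
Proof.
elim=> [p np|u1 u2 _ [c1 [N1 [c10 H1]]] _ [c2 [N2 [c20 H2]]]].
  exists (fun i => (i == p)%:R), p.+1; split=> // m pm.
  have pin : p \in index_iota n m by rewrite mem_index_iota np.
  split=> [|k]; rewrite (bigD1_seq p) ?iota_uniq//= eqxx big1.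
  - by rewrite addr0.
  - by move=> i /negbTE ->.
  - by rewrite mul1r addr0.
  - by move=> i /negbTE ->; rewrite mul0r.
exists (fun i => (c1 i + c2 i) / 2), (maxn N1 N2); split=> [i|m].
  by rewrite divr_ge0// addr_ge0.
rewrite geq_max => /andP[/H1[s1 e1] /H2[s2 e2]]; split=> [|k].
  by rewrite -mulr_suml big_split/= s1 s2; field.
rewrite e1 e2 -big_split/= mulr_suml; apply: eq_bigr => i _; ring.
Qed.

(* Simons' argument: if [y n] almost minimises the supremum of
   [2^(n+1) (V n) + y n], then the sum [v] of the [2^-(n+1) y n] is, at a point
   where it is maximal, at most [limsup h] up to an error. *)
Lemma simons {R : realType} {K : topologicalType} (h : nat -> K -> R) M d :
  compact [set: K] -> (forall n, continuous (h n)) ->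
  (forall n k, 0 <= h n k <= M) -> (forall k, (fun n => h n k) @ \oo --> (0 : R)) ->
  0 < d -> exists2 u, dyadic_conv h 0 u & forall k, u k <= d.
Proof.
move=> cK hc hM h0 d0.
have [[k0]|noK] := pselect (inhabited K); last first.
  by exists (h 0%N); [exact: dyadic_gen|move=> k; case: noK].
have hge0 p k : 0 <= h p k by case/andP: (hM p k).
have hleM p k : h p k <= M by case/andP: (hM p k).
(* The conclusion will be [y 0 / 2 <= v <= 2 * D], hence [D = d / 4]. Step [n] of the estimate costs
   [2 * dl n], and these costs add up to [D]. *)
pose D := d / 4; have D0 : 0 < D by rewrite divr_gt0.
pose dl n : R := D / 4 / 2 ^+ n.
have dl0 n : 0 < dl n by rewrite !divr_gt0// exprn_gt0.
have /choice[pick pickP] (nw : nat * (K -> R)) : exists y,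
    dyadic_conv h nw.1 y /\ forall x, dyadic_conv h nw.1 x ->
    supnorm (fun k => 2 ^+ nw.1.+1 * nw.2 k + y k) <=
    supnorm (fun k => 2 ^+ nw.1.+1 * nw.2 k + x k) + dl nw.1.
  apply: (near_min (Q := fun y => supnorm (fun k => 2 ^+ nw.1.+1 * nw.2 k + y k)));
    [exact: dl0|by eexists; apply: dyadic_gen (leqnn _)|].
  by move=> x; exact: supnorm_ge0.
pose V := fix V n : K -> R := if n is n'.+1 then
  (fun k => V n' k + pick (n', V n') k / 2 ^+ n'.+1) else (fun=> 0).
pose y n := pick (n, V n).
have VS n k : V n.+1 k = V n k + y n k / 2 ^+ n.+1 by [].
have yD n : dyadic_conv h n (y n) := (pickP (n, V n)).1.
have y0 n k : 0 <= y n k by apply: dyadic_conv_ge0 (yD n) => p; exact: hge0.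
have e2 n : 0 < 2 ^+ n :> R by rewrite exprn_gt0.
have VD n j k s : (forall p, (n <= p)%N -> h p k <= s) ->
    V (n + j)%N k <= V n k + s * (1 / 2 ^+ n - 1 / 2 ^+ (n + j)%N).
  move=> hs; elim: j => [|j IH]; first by rewrite addn0 subrr mulr0 addr0.
  rewrite addnS VS.
  have ys : y (n + j)%N k <= s.
    by apply: dyadic_conv_le (yD _) => p njp; apply: hs; exact: leq_trans (leq_addr _ _) njp.
  have : y (n + j)%N k / 2 ^+ (n + j).+1 <= s / 2 ^+ (n + j).+1.
    by rewrite ler_pM2r// invr_gt0.
  have : s * (1 / 2 ^+ (n + j)) = 2 * (s / 2 ^+ (n + j).+1) :> R.
    by rewrite exprS; field; rewrite gt_eqF.
  move: IH; rewrite !mulrBr !div1r; lra.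
have Vmono n j k : V n k <= V (n + j)%N k.
  elim: j => [|j IH]; first by rewrite addn0.
  by rewrite addnS VS (le_trans IH)// lerDl divr_ge0// ltW.
have Vc n : continuous (V n).
  elim: n => [|n IH] x; first exact: cvg_cst.
  apply: cvgD; first exact: IH.
  apply: cvgM; last exact: cvg_cst.
  exact: (dyadic_conv_continuous hc (yD n)).
have M0 : 0 <= M by exact: le_trans (hge0 0%N k0) (hleM 0%N k0).
have pow_small (C e : R) : 0 <= C -> 0 < e -> exists n, forall m, (n <= m)%N ->
    C / 2 ^+ m <= e.
  move=> C0 e0; have [n Hn] := invS_cvg0 C e0; exists n => m /Hn.
  apply: le_trans; rewrite ler_wpM2l// lef_pV2 ?posrE// -natrX ler_nat.
  exact: ltn_expl.
have [v vV] : exists v : K -> R, forall n k, `|v k - V n k| <= M / 2 ^+ n.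
  apply: uniform_cauchy_limit => [|n m k nm].
    apply/cvgn_distP => e e0; have [n Hn] := pow_small M e M0 e0.
    by exists n => m /Hn; rewrite subr0 ger0_norm// divr_ge0// ltW.
  have := VD n (m - n)%N k M (fun p _ => hleM p k).
  rewrite subnKC// => VDm; have := Vmono n (m - n)%N k; rewrite subnKC// => Vm.
  rewrite distrC ger0_norm ?subr_ge0// lerBlDl (le_trans VDm)// lerD2l ler_wpM2l//.
  by rewrite div1r gerDl oppr_le0 divr_ge0// ltW.
have vc : continuous v.
  apply: ulim_continuous => e e0; have [n Hn] := pow_small M e M0 e0.
  by exists (V n) => // k; rewrite (le_trans (vV n k))// Hn.
have Vv n k : V n k <= v k.
  apply/ler_addgt0Pl => e e0; have [m Hm] := pow_small M e M0 e0.
  have := vV (n + m)%N k; rewrite ler_distl => /andP[H _].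
  have := Hm (n + m)%N (leq_addl _ _); have := Vmono n m k; lra.
have vle n k s : 0 <= s -> (forall p, (n <= p)%N -> h p k <= s) ->
    v k <= V n k + s / 2 ^+ n.
  move=> s0 hs; apply/ler_addgt0Pl => e e0; have [m Hm] := pow_small M e M0 e0.
  have := vV (n + m)%N k; rewrite ler_distl => /andP[_ H].
  have := Hm (n + m)%N (leq_addl _ _); have := VD n m k s hs.
  have : 0 <= s * (1 / 2 ^+ (n + m)) by rewrite mulr_ge0// divr_ge0// ltW.
  rewrite mulrBr div1r; lra.
have [b vb] := compact_max k0 cK vc.
(* The rescaled tail [2^n (V (n + j) - V n)] has weights [1/2, ..., 1/2^j]; giving the missing
   [1/2^j] to [z] completes it to a competitor of [y n]. *)
have tail_conv n j z : dyadic_conv h (n + j) z ->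
    dyadic_conv h n (fun k => 2 ^+ n * (V (n + j)%N k - V n k) + z k / 2 ^+ j).
  elim: j z => [|j IH] z zD.
    rewrite (_ : (fun k => _) = z); first by rewrite addn0 in zD.
    by apply/funext => k; rewrite addn0 subrr mulr0 add0r divr1.
  have zD' : dyadic_conv h (n + j) z by apply: dyadic_conv_mono zD; rewrite addnS.
  have := IH _ (dyadic_mid (yD _) zD'); congr dyadic_conv; apply/funext => k.
  rewrite addnS VS !exprS exprD; field.
  by rewrite !gt_eqF.
(* Induction: [2^(n+1) V (n+1) = 2^(n+1) V n + y n] is compared with the competitor, for which the
   sum is [2^n V n + 2^n V (n + j)] plus a small term. The first summand is bounded by induction,
   the second by [2^n * v b]. *)
have Vbound n k : 2 ^+ n * V n k <= (2 ^+ n - 1) * v b + D * (1 - 1 / 2 ^+ n).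
  elim: n k => [|n IH] k.
    by rewrite expr0 mulr0 subrr mul0r add0r divr1 subrr mulr0.
  have [j Hj] := pow_small M (dl n) M0 (dl0 n).
  have := (pickP (n, V n)).2 _ (tail_conv n j (h (n + j)%N) (dyadic_gen _ (leqnn _))).
  rewrite /= -/(y n); set S1 := supnorm _; set S2 := supnorm _ => S12.
  have v0 : 0 <= v b by have := Vv 0%N b.
  have e1 m : 1 <= 2 ^+ m :> R by rewrite exprn_ege1// ler1n.
  have i1 m : 1 / 2 ^+ m <= 1 :> R by rewrite div1r invf_le1.
  have HS2 : S2 <= (2 ^+ n.+1 - 1) * v b + D * (1 - 1 / 2 ^+ n) + dl n.
    apply: supnorm_le => [|t].
      rewrite addr_ge0 ?(ltW (dl0 n))// addr_ge0// mulr_ge0 ?subr_ge0//.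
      exact: ltW.
    have Vn0 m : 0 <= V m t by have := Vmono 0%N m t; rewrite add0n.
    rewrite ger0_norm; last first.
      apply: addr_ge0; first by rewrite mulr_ge0 ?(ltW (e2 _)).
      by apply: addr_ge0; rewrite ?divr_ge0 ?mulr_ge0 ?subr_ge0 ?Vmono ?(ltW (e2 _)).
    have h1 : h (n + j)%N t / 2 ^+ j <= dl n.
      by apply: le_trans (Hj j (leqnn _)); rewrite ler_pM2r// invr_gt0.
    have h2 : 2 ^+ n * V (n + j)%N t <= 2 ^+ n * v b.
      by rewrite ler_pM2l// (le_trans (Vv _ _)).
    have := IH t; rewrite !exprS; lra.
  have HS1 : 2 ^+ n.+1 * V n.+1 k <= S1.
    have -> : 2 ^+ n.+1 * V n.+1 k = 2 ^+ n.+1 * V n k + y n k.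
      by rewrite VS mulrDr mulrCA divff ?mulr1// gt_eqF.
    apply: le_trans (ler_norm _) _.
    apply: (supnorm_ub (M := 2 ^+ n.+1 * v b + M) k) => t.
    have Vn0 : 0 <= V n t by have := Vmono 0%N n t; rewrite add0n.
    rewrite ger0_norm; last by rewrite addr_ge0 ?mulr_ge0 ?(ltW (e2 _)).
    rewrite lerD//; first by rewrite ler_pM2l// (le_trans (Vv _ _)).
    by apply: dyadic_conv_le (yD n).
  have E : dl n + dl n = D * (1 / 2 ^+ n - 1 / 2 ^+ n.+1).
    by rewrite /dl exprS; field; rewrite gt_eqF.
  apply: (le_trans HS1); apply: (le_trans S12); apply: le_trans (lerD HS2 (lexx _)) _.
  rewrite -!addrA lerD2l E -mulrDr ler_pM2l//.
  lra.
(* From some [n] on, [h p b <= D], so [2^n * v b] exceeds [2^n * V n b] by at most [D]. In [Vbound]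
   only [2^n - 1] copies of [v b] appear, so one copy is left on the other side. *)
have vb2 : v b <= 2 * D.
  have /cvgn_distP/(_ D D0)[n hn] := h0 b.
  have hn' p : (n <= p)%N -> h p b <= D.
    by move=> /hn; rewrite subr0 => H; exact: le_trans (ler_norm _) H.
  have H1 := vle n b D (ltW D0) hn'; have H2 := Vbound n b.
  have H3 : 2 ^+ n * v b <= 2 ^+ n * V n b + D.
    have -> : 2 ^+ n * V n b + D = 2 ^+ n * (V n b + D / 2 ^+ n).
      by field; rewrite gt_eqF.
    by rewrite ler_pM2l.
  have : 0 <= D * (1 / 2 ^+ n) by rewrite mulr_ge0 ?(ltW D0)// divr_ge0// ltW.
  lra.
exists (y 0%N); first exact: yD.
move=> k; have := Vv 1%N k; rewrite VS expr1 add0r => H.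
by have := vb k; rewrite /D in vb2; lra.
Qed.

Lemma convex_uniformly_null {R : realType} {K : topologicalType}
    (h : nat -> K -> R) M n d :
  compact [set: K] -> (forall n, continuous (h n)) ->
  (forall n k, 0 <= h n k <= M) -> (forall k, (fun n => h n k) @ \oo --> (0 : R)) ->
  0 < d -> exists m (c : nat -> R), (n < m)%N /\ (forall i, 0 <= c i) /\
    \sum_(n <= i < m) c i = 1 /\
    forall k, \sum_(n <= i < m) c i * h i k <= d.
Proof.
move=> cK hc hM h0 d0.
have [||||u uD ud] := @simons R K (fun i => h (i + n)%N) M d cK.
- by move=> i; exact: hc.
- by move=> i k; exact: hM.
- move=> k; apply/cvgn_distP => e e0.
  have /cvgn_distP/(_ e e0)[N HN] := h0 k.
  by exists N => i Ni; apply: HN; exact: leq_trans (leq_addr _ _).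
- exact: d0.
have uD' : dyadic_conv h n u.
  elim: uD => [p _|u1 u2 _ H1 _ H2]; last exact: dyadic_mid.
  by apply: dyadic_gen; exact: leq_addl.
have [c [N [c0 /(_ (maxn N n.+1) (leq_maxl _ _))[c1 uE]]]] := dyadic_convE uD'.
exists (maxn N n.+1), c; split; first by rewrite leq_maxr.
by split=> //; split=> // k; rewrite -uE.
Qed.

(** * Blocks of bounded variation and their differences *)

Lemma sum_half_pow {R : realType} N : \sum_(i < N) 1 / 2 ^+ i <= 2 :> R.
Proof.
suff -> : \sum_(i < N) 1 / 2 ^+ i = 2 - 2 / 2 ^+ N :> R.
  by rewrite gerDl oppr_le0 divr_ge0// exprn_ge0.
elim: N => [|N IH]; first by rewrite big_ord0 expr0 divr1 subrr.
by rewrite big_ord_recr /= IH exprS; field; rewrite expf_neq0.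
Qed.

Lemma telescope_dist {R : realType} (F : nat -> R) n m : (n <= m)%N ->
  `|F m - F n| <= \sum_(n <= i < m) `|F i.+1 - F i|.
Proof. by move=> nm; rewrite -telescope_sumr// ler_norm_sum. Qed.

Lemma sum_blocks {R : realType} (D : nat -> R) (s : nat -> nat) m :
  (forall n, (s n < s n.+1)%N) ->
  \sum_(n < m) \sum_(s n <= i < s n.+1) D i = \sum_(s 0%N <= i < s m) D i.
Proof.
move=> sS; have s0 n : (s 0%N <= s n)%N.
  by elim: n => // n IH; rewrite (leq_trans IH)// ltnW.
elim: m => [|m IH]; first by rewrite big_ord0 big_geq.
by rewrite big_ord_recr/= IH [RHS](big_cat_nat (s0 m) (ltnW (sS m))).
Qed.

Lemma sum_nat_widen_le {R : realType} (D : nat -> R) a b :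
  (forall i, 0 <= D i) -> \sum_(a <= i < b) D i <= \sum_(i < b) D i.
Proof.
move=> D0; rewrite -(big_mkord xpredT D).
have [ab|ba] := leqP a b; last first.
  by rewrite (big_geq (ltnW ba)); apply: sumr_ge0.
by rewrite (big_cat_nat (leq0n a) ab)//= lerDr sumr_ge0.
Qed.

Lemma increasing_ge {s : nat -> nat} : (forall n, (s n < s n.+1)%N) ->
  forall n, (n <= s n)%N.
Proof. by move=> sS; elim=> // n IH; exact: leq_ltn_trans IH (sS n). Qed.

Lemma increasing_mono {s : nat -> nat} : (forall n, (s n < s n.+1)%N) ->
  forall n m, (n <= m)%N -> (s n <= s m)%N.
Proof.
move=> sS n m nm; rewrite -(subnKC nm); elim: (m - n)%N => [|j IH].
  by rewrite addn0.
by rewrite addnS (leq_trans IH)// ltnW.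
Qed.

Lemma subseq_variation {R : realType} (F : nat -> R) (s : nat -> nat) m :
  (forall n, (s n < s n.+1)%N) ->
  \sum_(n < m) `|F (s n.+1) - F (s n)| <= \sum_(i < s m) `|F i.+1 - F i|.
Proof.
move=> sS; apply: (le_trans (y := \sum_(s 0%N <= i < s m) `|F i.+1 - F i|)).
  by rewrite -sum_blocks// ler_sum// => n _; exact: telescope_dist (ltnW (sS n)).
by apply: sum_nat_widen_le => i.
Qed.

Definition block_comb {R : realType} {K : Type} (fs : nat -> K -> R)
    (lo : nat -> nat) (c : nat -> R) (n : nat) (k : K) : R :=
  \sum_(lo n <= i < lo n.+1) c i * fs i k.

Lemma block_comb_dist {R : realType} (c u : nat -> R) a b (l e : R) :
  (forall i, 0 <= c i) -> \sum_(a <= i < b) c i = 1 ->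
  (forall i, (a <= i)%N -> (i < b)%N -> `|u i - l| <= e) ->
  `|\sum_(a <= i < b) c i * u i - l| <= e.
Proof.
move=> c0 c1 H; rewrite -[l]mul1r -[in X in `|X|]c1 mulr_suml -sumrB.
rewrite (le_trans (ler_norm_sum _ _ _))// -[e]mul1r -[in leRHS]c1 mulr_suml.
rewrite !big_seq ler_sum// => i; rewrite mem_index_iota => /andP[ai ib].
by rewrite -mulrBr normrM ger0_norm// ler_wpM2l// H.
Qed.

Lemma block_comb_cvg {R : realType} {K : Type} (fs : nat -> K -> R) f lo c k :
  (forall n, (lo n < lo n.+1)%N) -> (forall i, 0 <= c i) ->
  (forall n, \sum_(lo n <= i < lo n.+1) c i = 1) ->
  (fun n => fs n k) @ \oo --> f ->
  (fun n => block_comb fs lo c n k) @ \oo --> (f : R).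
Proof.
move=> lS c0 c1 /cvgn_distP H; apply/cvgn_distP => e /H[N HN].
exists N => n Nn; apply: block_comb_dist => // i li _; apply: HN.
exact: leq_trans (leq_trans Nn (increasing_ge lS n)) li.
Qed.

Lemma DSC_variation {R : realType} (u : nat -> R) :
  cvg (series (fun n => `|u n.+1 - u n|) @ \oo) ->
  exists V, forall m, \sum_(i < m) `|u i.+1 - u i| <= V.
Proof.
move=> cu; exists (lim (series (fun n => `|u n.+1 - u n|) @ \oo)) => m.
have := nondecreasing_cvgn_le _ cu m; rewrite /series /= big_mkord; apply.
by apply/nondecreasing_seqP => n; rewrite big_nat_recr//= lerDl.
Qed.

(** Each block starts where the previous one ends, at precision [1/2^(lo n)], which is at most
    [1/2^n] because [n <= lo n]. *)
Lemma exists_blocks {R : realType} {K : topologicalType} (h : nat -> K -> R) M :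
  compact [set: K] -> (forall n, continuous (h n)) ->
  (forall n k, 0 <= h n k <= M) -> (forall k, (fun n => h n k) @ \oo --> (0 : R)) ->
  exists lo c, (forall n, (lo n < lo n.+1)%N) /\ (forall i, 0 <= c i) /\
    (forall n, \sum_(lo n <= i < lo n.+1) c i = 1) /\
    forall n k, \sum_(lo n <= i < lo n.+1) c i * h i k <= 1 / 2 ^+ n.
Proof.
move=> cK hc hM h0.
have /choice[nx /choice[cc H]] (n : nat) := @convex_uniformly_null
  R K h M n (1 / 2 ^+ n) cK hc hM h0 ltac:(by rewrite divr_gt0// exprn_gt0).
pose lo n := iter n nx 0%N.
have lS n : (lo n < lo n.+1)%N by case: (H (lo n)).
(* Every block comes with its own weights; an index lies in at most one block, and [b i] names it,
   so the weights glue to one sequence. *)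
have /choice[b bP] (i : nat) : exists n, forall n', (lo n' <= i < lo n'.+1)%N -> n' = n.
  have [[n /andP[n1 n2]]|nex] := pselect (exists n, lo n <= i < lo n.+1)%N.
    exists n => n' /andP[n'1 n'2]; apply/eqP; rewrite eqn_leq.
    apply/andP; split; rewrite leqNgt; apply/negP => /(increasing_mono lS) lt.
      by have := leq_trans (leq_trans n2 lt) n'1; rewrite ltnn.
    by have := leq_trans (leq_trans n'2 lt) n1; rewrite ltnn.
  by exists 0%N => n' Hn'; case: nex; exists n'.
have bE n (F : nat -> R -> R) : \sum_(lo n <= i < lo n.+1) F i (cc (lo (b i)) i)
    = \sum_(lo n <= i < lo n.+1) F i (cc (lo n) i).
  rewrite !big_seq; apply: eq_bigr => i; rewrite mem_index_iota => ii.
  by rewrite -(bP i n ii).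
exists lo, (fun i => cc (lo (b i)) i); split=> //; split=> [i|].
  by case: (H (lo (b i))) => _ [].
split=> [n|n k].
  by rewrite (bE n (fun _ x => x)); case: (H (lo n)) => _ [_ []].
rewrite (bE n (fun i x => x * h i k)).
case: (H (lo n)) => _ [_ [_ /(_ k) Hk]]; apply: le_trans Hk _.
rewrite !div1r lef_pV2 ?posrE ?exprn_gt0// ler_weXn2l ?ler1n//.
exact: increasing_ge.
Qed.

(** A convex block of [F] differs from its first entry [F (lo n) k] by at most the variation [B n]
    of [F] over the block. So [g n k] is within [1/2^n + B n] of [F (lo n) k]; these errors are
    summable, and so is the variation along [lo]. *)
Lemma block_variation {R : realType} {K : topologicalType} (f : K -> R) fs M :
  compact [set: K] -> DSC f -> (forall n, continuous (fs n)) ->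
  (forall n k, `|fs n k| <= M) -> (forall k, (fun n => fs n k) @ \oo --> f k) ->
  exists lo c, (forall n, (lo n < lo n.+1)%N) /\ (forall i, 0 <= c i) /\
    (forall n, \sum_(lo n <= i < lo n.+1) c i = 1) /\
    forall k, exists V, forall m,
      \sum_(n < m) `|block_comb fs lo c n.+1 k - block_comb fs lo c n k| <= V.
Proof.
move=> cK [F [Fc [[M' FM] [Ff Fv]]]] fc fM ff.
have [|||lo [c [lS [c0 [c1 Hc]]]]] :=
  @exists_blocks R K (fun n k => `|fs n k - F n k|) (M + M') cK.
- move=> n k; apply: cvg_norm; apply: cvgB; [exact: fc|exact: Fc].
- by move=> n k; rewrite normr_ge0 (le_trans (ler_normB _ _))// lerD.
- move=> k; rewrite -(normr0 R) -(subrr (f k)).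
  by apply: cvg_norm; apply: cvgB; [exact: ff|exact: Ff].
exists lo, c; split=> //; split=> //; split=> // k.
have [Phi HPhi] := DSC_variation (Fv k).
pose D i := `|F i.+1 k - F i k|.
pose B n := \sum_(lo n <= i < lo n.+1) D i.
have D0 i : 0 <= D i := normr_ge0 _.
have B0 n : 0 <= B n by apply: sumr_ge0.
have SB m : \sum_(n < m) B n <= Phi.
  by rewrite sum_blocks// (le_trans (sum_nat_widen_le _ _ D0)).
have gF n : `|block_comb fs lo c n k - F (lo n) k| <= 1 / 2 ^+ n + B n.
  have -> : block_comb fs lo c n k - F (lo n) k =
      \sum_(lo n <= i < lo n.+1) c i * (fs i k - F i k) +
      (\sum_(lo n <= i < lo n.+1) c i * F i k - F (lo n) k).
    rewrite addrA; congr (_ - _); rewrite -big_split; apply: eq_bigr => i _ /=.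
    by rewrite -mulrDr subrK.
  rewrite (le_trans (ler_normD _ _))// lerD//.
    rewrite (le_trans _ (Hc n k))// (le_trans (ler_norm_sum _ _ _))// ler_sum// => i _.
    by rewrite normrM ger0_norm.
  apply: block_comb_dist => // i li il.
  rewrite (le_trans (telescope_dist (fun i => F i k) li))//.
  by rewrite /B (big_cat_nat li (ltnW il))//= lerDl sumr_ge0.
(* [Phi + 2] comes from the error at [n + 1], the middle [Phi] from the increment of [F] along [lo],
   and the last [Phi + 2] from the error at [n]. *)
exists (Phi + 2 + (Phi + Phi + 2)) => m.
apply: (@le_trans _ _ (\sum_(n < m) ((1 / 2 ^+ n + B n.+1) +
    (B n + (1 / 2 ^+ n + B n))))).
  apply: ler_sum => n _.
  have -> : block_comb fs lo c n.+1 k - block_comb fs lo c n k =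
      (block_comb fs lo c n.+1 k - F (lo n.+1) k) +
      ((F (lo n.+1) k - F (lo n) k) - (block_comb fs lo c n k - F (lo n) k)).
    by ring.
  rewrite (le_trans (ler_normD _ _))// lerD//.
    rewrite (le_trans (gF _))// lerD2r !div1r lef_pV2 ?posrE ?exprn_gt0//.
    by rewrite ler_weXn2l// ler1n.
  rewrite (le_trans (ler_normB _ _))// lerD//.
  exact: (telescope_dist (fun i => F i k) (ltnW (lS n))).
have SB1 : \sum_(n < m) B n.+1 <= Phi.
  apply: le_trans (SB m.+1); rewrite big_ord_recl /= lerDr//.
rewrite !big_split/=; have := SB m; have := @sum_half_pow R m; lra.
Qed.

(** The first entry is [g 0] itself, so that partial sums telescope to [g n] and the closed span
    does not change. *)
Definition diffs {R : realType} {K : Type} (g : nat -> K -> R) (n : nat) (k : K) : R :=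
  if n is n'.+1 then g n'.+1 k - g n' k else g 0%N k.

(** Let [A] be the largest [|a n|]. The off-diagonal part of a row is at most [A * (x / 8) * 2], so
    [(x / 2) * A <= 2 * e + (x / 4) * A]. *)
Lemma diag_dominant {R : realType} N (w : nat -> nat -> R) (a : nat -> R) (x e : R) :
  0 < x -> 0 <= e -> (forall n, x / 2 <= `|w n n|) ->
  (forall n i, i != n -> `|w n i| <= x / 8 / 2 ^+ i) ->
  (forall n, (n < N)%N -> `|\sum_(i < N) a i * w n i| <= 2 * e) ->
  forall n, (n < N)%N -> `|a n| <= 8 / x * e.
Proof.
move=> x0 e0 wd wo H.
pose A := \big[Order.max/0]_(i < N) `|a i|.
have aA n : (n < N)%N -> `|a n| <= A.
  by move=> nN; exact: (le_bigmax 0 (fun i : 'I_N => `|a i|) (Ordinal nN)).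
have A0 : 0 <= A by exact: bigmax_ge_id.
suff A2 : A <= 4 / x * e + A / 2.
  move=> n nN; apply: le_trans (aA n nN) _.
  have -> : 8 / x * e = 2 * (4 / x * e) by ring.
  lra.
apply: bigmax_le => [|n _].
  by rewrite addr_ge0// ?divr_ge0// mulr_ge0// divr_ge0// ltW.
have Hn := H n (ltn_ord n).
pose S := \sum_(i < N | i != n) a i * w n i.
have SA : `|S| <= x / 4 * A.
  rewrite (le_trans (ler_norm_sum _ _ _))//.
  apply: (@le_trans _ _ (\sum_(i < N | i != n) A * (x / 8) * (1 / 2 ^+ i))).
    apply: ler_sum => i inn; rewrite normrM -mulrA ler_pM ?aA//.
    by rewrite mulrA mulr1 wo.
  apply: (@le_trans _ _ (\sum_(i < N) A * (x / 8) * (1 / 2 ^+ i))).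
    rewrite [leRHS](bigD1 n)//= lerDr !mulr_ge0// ?ltW// invr_ge0 exprn_ge0//.
  rewrite -mulr_sumr (le_trans (ler_wpM2l _ (sum_half_pow _)))//.
    by rewrite mulr_ge0// divr_ge0// ltW.
  by have -> : A * (x / 8) * 2 = x / 4 * A by field.
have aw : `|a n * w n n| <= 2 * e + x / 4 * A.
  have -> : a n * w n n = \sum_(i < N) a i * w n i - S.
    by rewrite (bigD1 n)//= addrK.
  by rewrite (le_trans (ler_normB _ _))// lerD.
have : `|a n| * (x / 2) <= 2 * e + x / 4 * A.
  by apply: le_trans aw; rewrite normrM ler_wpM2l.
rewrite -ler_pdivlMr ?divr_gt0// => /le_trans; apply.
by rewrite le_eqVlt; apply/orP; left; apply/eqP; field; rewrite gt_eqF.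
Qed.

Lemma discontinuity_gap {R : realType} {K : topologicalType} (f : K -> R) :
  ~ continuous f -> exists k0 r, 0 < r /\
    forall A, nbhs k0 A -> exists2 p, A p & r <= `|f p - f k0|.
Proof.
move=> fnc; apply: contrapT => H; apply: fnc => k; apply/cvgrPdist_lt => e e0.
apply: contrapT => nne; apply: H; exists k, e; split=> // A Ak.
apply: contrapT => nex; apply: nne; apply: filterS Ak => p Ap /=.
by rewrite ltNge distrC; apply/negP => ep; apply: nex; exists p.
Qed.

Lemma nbhs_close_upto {R : realType} {K : topologicalType} (g : nat -> K -> R)
    k (e : R) m :
  (forall n, continuous (g n)) -> 0 < e ->
  nbhs k [set p | forall i, (i < m)%N -> `|g i p - g i k| <= e].
Proof.
move=> gc e0; elim: m => [|m IH]; first by apply: filterS filterT => p _ i.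
have /cvgrPdist_le/(_ e e0) H := gc m k.
apply: filterS (filterI IH H) => p [/= H1 H2] i.
by rewrite ltnS leq_eqVlt => /orP[/eqP ->|/H1//]; rewrite distrC.
Qed.

Lemma cvg_on_seq {R : realType} {K : topologicalType} (g : nat -> K -> R) f
    (s : seq K) (e : R) n0 :
  (forall k, (fun n => g n k) @ \oo --> f k) -> 0 < e ->
  exists2 N, (n0 < N)%N & forall n, (N <= n)%N -> forall z, z \in s ->
    `|g n z - f z| <= e.
Proof.
move=> gf e0; elim: s => [|z s [N nN IH]]; first by exists n0.+1.
have /cvgn_distP/(_ e e0)[N' HN'] := gf z.
exists (maxn N N'); first by rewrite leq_max nN.
move=> n; rewrite geq_max => /andP[Nn N'n] y.
by rewrite inE => /orP[/eqP ->|/IH]; [exact: HN'|exact].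
Qed.

(* Along a subsequence the differences are almost biorthogonal to the functionals
   [x q] and [x (p j) - x k0], where [f q != 0] and [p j] approaches a point of
   discontinuity [k0]. *)
Lemma diffs_dominate {R : realType} {K : topologicalType} (g : nat -> K -> R)
    (f : K -> R) :
  (forall n, continuous (g n)) -> (forall k, (fun n => g n k) @ \oo --> f k) ->
  ~ continuous f ->
  exists s (C : R), (forall n, (s n < s n.+1)%N) /\ 0 < C /\
    forall N a e, (forall k, `|comb (diffs (fun n => g (s n))) N a k| <= e) ->
      forall n, (n < N)%N -> `|a n| <= C * e.
Proof.
move=> gc gf fnc.
have [q fq] : exists q, f q != 0.
  apply: contrapT => H; apply: fnc; rewrite (_ : f = fun=> 0).
    by move=> x; exact: cvg_cst.
  apply/funext => k; apply/eqP; rewrite -[_ == _]negbK; apply/negP => fk.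
  by apply: H; exists k.
have [k0 [r [r0 Hr]]] := discontinuity_gap fnc.
pose x := Order.min `|f q| r.
have x0 : 0 < x by rewrite lt_min normr_gt0 fq.
have xq : x <= `|f q| by rewrite ge_min lexx.
have xr : x <= r by rewrite ge_min lexx orbT.
(* An off-diagonal entry may be as large as [x / 8 / 2^i = 16 * (th / 2^i)]. *)
pose th := x / 128; have th0 : 0 < th by rewrite divr_gt0.
have e2 n : 0 < 2 ^+ n :> R by rewrite exprn_gt0.
have dec n m : (n <= m)%N -> th / 2 ^+ m <= th / 2 ^+ n.
  by move=> nm; rewrite ler_wpM2l ?(ltW th0)// lef_pV2 ?posrE// ler_weXn2l// ler1n.
have /choice[P HP] (m : nat) : exists p,
    (forall i, (i <= m)%N -> `|g i p - g i k0| <= th / 2 ^+ m) /\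
    r <= `|f p - f k0|.
  have [p H1 H2] := Hr _ (nbhs_close_upto k0 m.+1 gc (divr_gt0 th0 (e2 m))).
  by exists p.
pose pts m := q :: k0 :: [seq P i | i <- iota 0 m.+1].
have /choice[nx Hnx] (m : nat) : exists N, (m < N)%N /\ forall n, (N <= n)%N ->
    forall z, z \in pts m -> `|g n z - f z| <= th / 2 ^+ m.
  by have [N] := cvg_on_seq (pts m) m gf (divr_gt0 th0 (e2 m)); exists N.
(* Starting at [nx 0] makes already [g (s 0)] close to [f] at [q] and [k0]. Afterwards [p j] is
   chosen so that [g i] with [i <= s j] does not yet see the jump of [f], and [s (j+1)] so that
   later terms do. *)
pose s n := iter n.+1 nx 0%N.
have sS n : (s n < s n.+1)%N by case: (Hnx (s n)).
have sge := increasing_ge sS; have smono := increasing_mono sS.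
pose p j := P (s j).
have Hqk t z : z \in [:: q; k0] -> `|g (s t) z - f z| <= 2 * (th / 2 ^+ t).
  move=> zqk; have zp m : z \in pts m.
    by move: zqk; rewrite !inE => /orP[]->; rewrite ?orbT.
  case: t => [|t].
    have := (Hnx 0%N).2 _ (leqnn _) z (zp _); rewrite !expr0 !divr1; lra.
  have := (Hnx (s t)).2 _ (leqnn _) z (zp _) => H.
  apply: le_trans H (le_trans (dec _ _ (sge t)) _).
  by rewrite exprS le_eqVlt; apply/orP; left; apply/eqP; field; rewrite gt_eqF.
have Hp t j : (j < t)%N -> `|g (s t) (p j) - f (p j)| <= 2 * (th / 2 ^+ t).
  case: t => // t jt.
  have zp : p j \in pts (s t).
    have : P (s j) \in [seq P i | i <- iota 0 (s t).+1].
      by apply: map_f; rewrite mem_iota add0n ltnS smono.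
    move=> pj; rewrite /pts in_cons; apply/orP; right.
    by rewrite in_cons; apply/orP; right.
  have := (Hnx (s t)).2 _ (leqnn _) _ zp => H.
  apply: le_trans H (le_trans (dec _ _ (sge t)) _).
  by rewrite exprS le_eqVlt; apply/orP; left; apply/eqP; field; rewrite gt_eqF.
have Hlow t j : (t <= j)%N -> `|g (s t) (p j) - g (s t) k0| <= th / 2 ^+ j.
  move=> tj; apply: le_trans ((HP (s j)).1 _ (smono _ _ tj)) _.
  exact: dec (sge j).
pose W n (y : K -> R) := if n is j.+1 then y (p j) - y k0 else y q.
pose d := diffs (fun n => g (s n)).
have k0qk : k0 \in [:: q; k0] by rewrite !inE eqxx orbT.
have qqk : q \in [:: q; k0] by rewrite !inE eqxx.
have thalf i : th / 2 ^+ i = 2 * (th / 2 ^+ i.+1).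
  by rewrite exprS; field; rewrite gt_eqF.
exists s, (8 / x); split=> //; split; first by rewrite divr_gt0.
move=> N a e He.
have [noK|e0] := ltP e 0.
  by have := le_lt_trans (He q) noK; rewrite ltNge normr_ge0.
apply: (diag_dominant (w := fun n i => W n (d i)) x0 e0).
- move=> [|j] /=.
    have := Hqk 0%N q qqk; rewrite expr0 divr1 distrC => H.
    have := lerB_dist (f q) (g (s 0%N) q); rewrite /th in H; lra.
  have H1 := Hp j.+1 j (ltnSn j); have H2 := Hqk j.+1 k0 k0qk.
  have H3 := Hlow j j (leqnn j); have H4 := (HP (s j)).2.
  have H5 := dec 0%N j (leq0n _); rewrite expr0 divr1 in H5.
  have H6 := thalf j; rewrite -/(p j) in H4.
  have : `|f (p j) - f k0| <= `|g (s j.+1) (p j) - f (p j)| +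
     `|g (s j.+1) k0 - f k0| + `|g (s j) (p j) - g (s j) k0| +
     `|g (s j.+1) (p j) - g (s j) (p j) - (g (s j.+1) k0 - g (s j) k0)|.
    have -> : f (p j) - f k0 = - (g (s j.+1) (p j) - f (p j)) +
      (g (s j.+1) k0 - f k0) + (g (s j) (p j) - g (s j) k0) +
      (g (s j.+1) (p j) - g (s j) (p j) - (g (s j.+1) k0 - g (s j) k0)) by ring.
    rewrite (le_trans (ler_normD _ _))// lerD2r (le_trans (ler_normD _ _))// lerD2r.
    by rewrite (le_trans (ler_normD _ _))// normrN.
  rewrite /th in H1 H2 H3 H5 H6 *; lra.
- move=> n i.
  have -> : x / 8 / 2 ^+ i = 16 * (th / 2 ^+ i) by rewrite /th; field; rewrite gt_eqF.
  have thp m : 0 <= th / 2 ^+ m by rewrite divr_ge0// ltW.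
  case: n i => [|j] [|i] // inj; rewrite /W /d /=.
  + have H1 := Hqk i.+1 q qqk; have H2 := Hqk i q qqk; have H3 := thalf i.
    have H4 := thp i.+1.
    rewrite (le_trans (ler_distD (f q) _ _))// (distrC (f q)); lra.
  + by have := Hlow 0%N j (leq0n _); have := dec 0%N j (leq0n _); have := thp 0%N; lra.
  have -> : g (s i.+1) (p j) - g (s i) (p j) - (g (s i.+1) k0 - g (s i) k0) =
    (g (s i.+1) (p j) - g (s i.+1) k0) - (g (s i) (p j) - g (s i) k0) by ring.
  (* For [i < j] both functions take nearly the same value at [p j] and [k0]. For [i > j] both are
     near [f] at these points, and the two jumps cancel. *)
  have [ij|ji] := ltnP i j.
    have H1 := Hlow _ _ ij; have H2 := Hlow _ _ (ltnW ij).
    have H3 := dec _ _ ij; have H4 := thp i.+1.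
    rewrite (le_trans (ler_normB _ _))//; lra.
  have {}ji : (j < i)%N by rewrite ltn_neqAle ji andbT eq_sym -eqSS.
  have H1 := Hp _ _ ji; have H2 := Hp _ _ (leqW ji).
  have H3 := Hqk i k0 k0qk; have H4 := Hqk i.+1 k0 k0qk.
  have H5 := thalf i; have H6 := thp i.+1.
  have -> : (g (s i.+1) (p j) - g (s i.+1) k0) - (g (s i) (p j) - g (s i) k0) =
    (g (s i.+1) (p j) - f (p j)) - (g (s i.+1) k0 - f k0) -
    ((g (s i) (p j) - f (p j)) - (g (s i) k0 - f k0)) by ring.
  rewrite (le_trans (ler_normB _ _))//.
  have := ler_normB (g (s i.+1) (p j) - f (p j)) (g (s i.+1) k0 - f k0).
  have := ler_normB (g (s i) (p j) - f (p j)) (g (s i) k0 - f k0).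
  lra.
move=> n _.
have -> : \sum_(i < N) a i * W n (d i) = W n (comb d N a).
  by case: n => // j; rewrite /W /comb -sumrB; apply: eq_bigr => i _; rewrite mulrBr.
case: n => [|j]; rewrite /W; first by apply: le_trans (He q) _; lra.
by rewrite (le_trans (ler_normB _ _))// mulr2n mulrDl mul1r lerD.
Qed.

Lemma closed_span_sub {R : realType} {J : Type} (g g' : nat -> J -> R) h :
  (forall n, exists N a, forall j, g n j = comb g' N a j) ->
  closed_span g h -> closed_span g' h.
Proof.
move=> gg' /closed_spanP H; apply/closed_spanP => e /H[N [a Ha]].
suff [P [c Hc]] : exists P c, forall j, comb g N a j = comb g' P c j.
  by exists P, c => j; rewrite -Hc.
elim: N {Ha} => [|N [P [c IH]]].
  by exists 0%N, (fun=> 0) => j; rewrite /comb !big_ord0.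
have [Q [b Hb]] := gg' N; have [S [d Hd]] := comb_lin g' Q b P c (a N).
exists S, d => j; rewrite Hd -IH -Hb.
by rewrite [LHS]big_ord_recr addrC.
Qed.

Lemma closed_span_diffs {R : realType} {K : Type} (g : nat -> K -> R) :
  closed_span (diffs g) = closed_span g.
Proof.
have single (h : nat -> K -> R) n : exists N a, forall j, h n j = comb h N a j.
  exists n.+1, (fun i => (i == n)%:R) => j.
  rewrite /comb big_ord_recr/= eqxx mul1r big1 ?add0r//.
  by move=> k _ /=; rewrite (ltn_eqF (ltn_ord k)) mul0r.
apply/seteqP; split=> h; apply: closed_span_sub.
  move=> [|n]; first exact: (single g 0%N).
  have [N [a Ha]] := single g n; have [M [b Hb]] := single g n.+1.
  have [P [c Hc]] := comb_lin g N a M b (-1).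
  by exists P, c => j; rewrite Hc -Ha -Hb /= mulN1r addrC.
move=> n; exists n.+1, (fun=> 1) => j; rewrite /comb.
under eq_bigr do rewrite mul1r.
elim: n => [|n IH]; first by rewrite big_ord_recr big_ord0 /= add0r.
by rewrite big_ord_recr/= -IH addrC subrK.
Qed.

(** * The polyhedral renorming *)

Lemma tail_small {R : realType} (D : nat -> R) V e :
  (forall i, 0 <= D i) -> (forall m, \sum_(i < m) D i <= V) -> 0 < e ->
  exists N, forall m, \sum_(N <= i < m) D i <= e.
Proof.
move=> D0 DV e0.
have hs : has_sup [set \sum_(i < m) D i | m in [set: nat]].
  by split; [exists (\sum_(i < 0) D i), 0%N|exists V => _ [m _ <-]].
have [_ [N _ <-] HN] := sup_adherent e0 hs.
exists N => m; have [mN|Nm] := leqP m N; first by rewrite big_geq// ltW.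
have : \sum_(i < m) D i <= sup [set \sum_(i < m) D i | m in [set: nat]].
  by apply: (ub_le_sup hs.2); exists m.
rewrite -!(big_mkord xpredT D) in HN *.
rewrite (big_cat_nat (leq0n N) (ltnW Nm))/=; lra.
Qed.

(** The net has to consist of points satisfying [P], because the tail bound of [rapid] is used at
    its points. One such point is taken in every cover member that contains any, which doubles the
    error; hence [e / 2]. *)
Lemma compact_net {R : realType} {K : topologicalType} (d : nat -> K -> R)
    (P : K -> Prop) N (e : R) (k0 : K) :
  compact [set: K] -> (forall n, continuous (d n)) -> 0 < e ->
  exists s : seq K, (forall b, b \in s -> P b) /\
    forall k, P k -> exists2 b, b \in s &
      \sum_(n < N) `|d n k - d n b| <= e.
Proof.
move=> cK dc e0; pose t := e / 2 / N.+1%:R.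
have t0 : 0 < t by rewrite !divr_gt0.
pose U x := [set p | forall i, (i < N)%N -> `|d i p - d i x| <= t].
have Ux x : nbhs x (U x) by exact: nbhs_close_upto.
(* [compact_cover] is only available on pointed spaces *)
pose Kp : ptopologicalType := HB.pack (Topological.sort K) (isPointed.Build K k0).
have : @cover_compact Kp [set: Kp] by rewrite -compact_cover; exact: cK.
move=> /(_ K setT (fun x => (U x)°)).
case=> [x _|x _|D _ KD]; first exact: open_interior.
  by exists x => //; exact: Ux.
pose b x := xget x [set p | P p /\ U x p].
exists [seq b x | x <- finmap.enum_fset D & `[< exists p, P p /\ U x p >]]; split.
  move=> z /mapP[x]; rewrite mem_filter => /andP[/asboolP[p Hp] _] ->.
  by case: (xgetI x (Hp : [set p | P p /\ U x p] p)).
move=> k Pk; have [x /= xD /interior_subset kx] := KD k Logic.I.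
have Pkx : [set p | P p /\ U x p] k by [].
exists (b x).
  apply: map_f; rewrite mem_filter xD andbT; apply/asboolP; by exists k.
have [_ bx] := xgetI x Pkx; rewrite -/(b x) in bx.
apply: (@le_trans _ _ (\sum_(n < N) (t + t))).
  apply: ler_sum => n _; rewrite (le_trans (ler_distD (d n x) _ _))// lerD//.
    exact: kx.
  by rewrite distrC; exact: bx.
rewrite sumr_const card_ord -[leLHS]mulr_natr.
have -> : e = (t + t) * N.+1%:R by rewrite /t -mulrDl -splitr divfK// pnatr_eq0.
by rewrite ler_wpM2l ?addr_ge0 ?(ltW t0)// ler_nat.
Qed.

Definition unit_seq {R : realType} (n i : nat) : R := (i == n)%:R.

(** A function [joinf h al] in the closed span of this family is a vector [h] together with its
    coordinate sequence [al]. *)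
Definition with_coords {R : realType} {K : Type} (d : nat -> K -> R) (n : nat) :
  K + nat -> R := joinf (d n) (unit_seq n).

Lemma comb_unit_seq {R : realType} N (a : nat -> R) i :
  comb unit_seq N a i = if (i < N)%N then a i else 0.
Proof.
rewrite /comb /unit_seq; have [iN|Ni] := ltnP i N.
  rewrite (bigD1 (Ordinal iN))//= eqxx mulr1 big1 ?addr0// => j /negbTE.
  by rewrite -val_eqE /= eq_sym => ->; rewrite mulr0.
rewrite big1// => j _; rewrite gtn_eqF ?mulr0//.
exact: leq_trans (ltn_ord j) Ni.
Qed.

Definition psum {R : realType} {K : Type} (d : nat -> K -> R) (N : nat)
  (al : nat -> R) (k : K) : R := \sum_(n < N) al n * d n k.

(** The points of rank [N]; a point of rank [N] has all larger ranks as well. *)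
Definition rapid {R : realType} {K : Type} (d : nat -> K -> R) (N : nat) (k : K) :=
  forall m, \sum_(N <= n < m) `|d n k| <= 1 / 2.

Section renorming.
Context {R : realType} {K : topologicalType} (d : nat -> K -> R) (C : R) (k0 : K).
Context (cK : compact [set: K]) (dc : forall n, continuous (d n))
  (dV : forall k, exists V, forall m, \sum_(n < m) `|d n k| <= V)
  (C0 : 0 < C)
  (dC : forall N a e, (forall k, `|comb d N a k| <= e) ->
    forall n, (n < N)%N -> `|a n| <= C * e).

Let good (h : K -> R) (al : nat -> R) :=
  closed_span (with_coords d) (joinf h al).

Let good_approx h al : good h al -> forall e, 0 < e -> exists N a,
  (forall k, `|h k - comb d N a k| <= e) /\
  (forall i, `|al i - (if (i < N)%N then a i else 0)| <= e).
Proof.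
move=> /closed_span_joinf H e /H[N [a [H1 H2]]]; exists N, a; split=> // i.
by rewrite -comb_unit_seq; exact: H2.
Qed.

Let good_gen N a : good (comb d N a) (fun i => if (i < N)%N then a i else 0).
Proof.
apply/closed_span_joinf => e e0; exists N, a; split=> [k|i].
  by rewrite subrr normr0 ltW.
by rewrite comb_unit_seq subrr normr0 ltW.
Qed.

Let dom_coords : comb_dom C d (@unit_seq R).
Proof.
move=> N a e H i; rewrite comb_unit_seq; case: ifPn => [iN|_].
  exact: (dC H).
rewrite normr0 mulr_ge0 ?(ltW C0)//; exact: le_trans (normr_ge0 _) (H k0).
Qed.

Let good_coord h al e : good h al -> (forall k, `|h k| <= e) ->
  forall n, `|al n| <= C * e.
Proof. by move=> hal; exact: (joinf_dom C0 dom_coords hal). Qed.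

Let good_continuous h al : good h al -> continuous h.
Proof.
move=> hal; apply: ulim_continuous => e /(good_approx hal)[N [a [H _]]].
exists (comb d N a) => //; rewrite /comb; elim: N {H} => [|N IH].
  under [X in continuous X]funext do rewrite big_ord0.
  by move=> k; exact: cvg_cst.
under [X in continuous X]funext do rewrite big_ord_recr.
move=> k; apply: cvgD; first exact: IH.
by apply: cvgM; [exact: cvg_cst|exact: dc].
Qed.

Let good_c0 h al e : good h al -> 0 < e ->
  exists N, forall n, (N <= n)%N -> `|al n| <= e.
Proof.
move=> hal /(good_approx hal)[N [a [_ H]]]; exists N => n Nn.
by have := H n; rewrite ltnNge Nn /= subr0.
Qed.

(** For finite combinations this is the tail bound of [rapid]. In general, coefficients are
    approximated within [t]: the tail contributes [(A + t) / 2] and the head [t * V]. *)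
Let good_psum h al N k A : good h al -> rapid d N k ->
  (forall n, (N <= n)%N -> `|al n| <= A) -> `|h k - psum d N al k| <= A / 2.
Proof.
move=> hal Nk alA; have [V HV] := dV k.
have A0 : 0 <= A := le_trans (normr_ge0 _) (alA _ (leqnn _)).
have V0 : 0 <= V by have := HV 0%N; rewrite big_ord0.
(* The errors total [t * (3/2 + V)], which is below [t * (2 + V) = e]. *)
apply/ler_addgt0Pl => e e0; pose t := e / (2 + V).
have V2 : 0 < 2 + V by rewrite ltr_pwDl.
have t0 : 0 < t by rewrite divr_gt0.
have [M [a [H1 H2]]] := good_approx hal t0.
pose a' i := if (i < M)%N then a i else 0.
pose P := maxn M N.
have -> : h k - psum d N al k = (h k - comb d M a k) +
   (\sum_(N <= n < P) a' n * d n k - \sum_(n < N) (al n - a' n) * d n k).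
  rewrite (comb_pad d a (leq_maxl M N)) -/P /comb -/a'.
  rewrite -(big_mkord xpredT (fun i => a' i * d i k)).
  rewrite (big_cat_nat (leq0n N) (leq_maxr M N))/= big_mkord /psum.
  under [in RHS]eq_bigr do rewrite ?mulrBl.
  under [X in _ = _ + (_ - X)]eq_bigr do rewrite mulrBl.
  rewrite sumrB; ring.
apply: (@le_trans _ _ (t + ((A + t) * (1 / 2) + t * V))); last first.
  have -> : e = t * (2 + V) by rewrite /t divfK// gt_eqF.
  lra.
rewrite (le_trans (ler_normD _ _))// lerD// (le_trans (ler_normB _ _))// lerD//.
  rewrite (le_trans (ler_norm_sum _ _ _))//.
  apply: (@le_trans _ _ ((A + t) * \sum_(N <= n < P) `|d n k|)); last first.
    by rewrite ler_wpM2l ?addr_ge0 ?(ltW t0)//; exact: Nk.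
  rewrite mulr_sumr !big_seq ler_sum// => n; rewrite mem_index_iota => /andP[Nn _].
  rewrite normrM ler_wpM2r// -[a' n](subKr (al n)).
  by rewrite (le_trans (ler_normB _ _))// lerD// ?alA//; exact: H2.
rewrite (le_trans (ler_norm_sum _ _ _))//.
apply: (@le_trans _ _ (t * \sum_(n < N) `|d n k|)).
  rewrite mulr_sumr ler_sum// => n _; rewrite normrM ler_wpM2r//; exact: H2.
by rewrite ler_wpM2l ?(ltW t0).
Qed.

Let ep (N : nat) : R := 1 / 2 ^+ N.

Let ep0 N : 0 < ep N. Proof. by rewrite divr_gt0// exprn_gt0. Qed.

Let ep1 N : ep N <= 1.
Proof. by rewrite /ep div1r invf_le1 ?exprn_gt0// exprn_ege1// ler1n. Qed.

Let ep_mono N M : (N <= M)%N -> ep M <= ep N.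
Proof.
by move=> NM; rewrite /ep !div1r lef_pV2 ?posrE ?exprn_gt0// ler_weXn2l// ler1n.
Qed.

Let ep_small e : 0 < e -> exists N, forall n, (N <= n)%N -> ep n <= e.
Proof.
move=> e0; have [n Hn] := invS_cvg0 1 e0; exists n => m /Hn.
apply: le_trans; rewrite ler_wpM2l// lef_pV2 ?posrE ?exprn_gt0// -natrX ler_nat.
exact: ltn_expl.
Qed.

(** With coordinates bounded by [C * H], this mesh moves the partial sum by at most [ep N / 8 * H],
    less than the weights can absorb. *)
Let net_ex N : exists s : seq K, (forall b, b \in s -> rapid d N b) /\
    forall k, rapid d N k -> exists2 b, b \in s &
      \sum_(n < N) `|d n k - d n b| <= ep N / (8 * C).
Proof. by apply: (compact_net _ _ k0) => //; rewrite divr_gt0// mulr_gt0. Qed.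

Let net N : seq K := projT1 (cid (net_ex N)).

Let net_rapid N b : b \in net N -> rapid d N b.
Proof. by move=> bN; exact: (projT2 (cid (net_ex N))).1. Qed.

Let net_dense N k : rapid d N k ->
  exists2 b, b \in net N & \sum_(n < N) `|d n k - d n b| <= ep N / (8 * C).
Proof. exact: (projT2 (cid (net_ex N))).2. Qed.

(** Rank, position in the net, and an optional signed coordinate. Out-of-range indices will give the
    zero functional, so a plain product serves as index set. *)
Let J : choiceType := (nat * nat * option (nat * bool))%type.

(* The truncated evaluations, with a weight which decreases once a further
   coordinate is added: this makes every limit of them strictly dominated. *)
Let phi (j : J) (h : nat -> R) : R :=
  let: (N, p, o) := j in
  if (p < size (net N))%N then
    let b := nth k0 (net N) p in
    match o with
    | None => (1 + ep N) * psum d N h b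
    | Some (n, sg) => if (N <= n)%N then
        (1 + ep N / 2) * psum d N h b + (-1) ^+ sg * h n else 0
    end
  else 0.

Let psum_lin N t h1 h2 k :
  psum d N (fun i => t * h1 i + h2 i) k = t * psum d N h1 k + psum d N h2 k.
Proof.
rewrite /psum mulr_sumr -big_split; apply: eq_bigr => i _ /=; ring.
Qed.

Let phi_lin j t h1 h2 :
  phi j (fun i => t * h1 i + h2 i) = t * phi j h1 + phi j h2.
Proof.
case: j => [[N p] [[n sg]|]]; rewrite /phi; case: ifP => _; try ring;
  rewrite ?psum_lin; try ring.
by case: ifP => _; ring.
Qed.

(** Listing the values of all functionals turns the new norm into a supremum norm on [J]: [spanT y]
    is the renormed space. *)
Let y (i : nat) (j : J) : R := phi j (unit_seq i).

Let comb_y N a j : comb y N a j = phi j (fun i => if (i < N)%N then a i else 0).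
Proof.
suff -> : comb y N a j = phi j (comb unit_seq N a).
  by congr phi; apply/funext => i; exact: comb_unit_seq.
elim: N => [|N IH].
  have phi0 : phi j (fun=> 0) = 0.
    have := phi_lin j (-1) (fun=> 0) (fun=> 0).
    by under [X in phi j X]funext do rewrite mulr0 addr0; rewrite mulN1r addNr.
  rewrite /comb big_ord0 -[LHS]phi0; congr phi.
  by apply/funext => i; rewrite big_ord0.
rewrite /comb big_ord_recr /=; rewrite -/(comb y N a j) IH.
have -> : (fun i => \sum_(i0 < N.+1) a i0 * unit_seq i0 i) =
    fun i => a N * unit_seq N i + comb unit_seq N a i :> R.
  by apply/funext => i; rewrite big_ord_recr /= addrC.
by rewrite phi_lin addrC.
Qed.

(** Only coordinates from [N] on enter [A]. With [A = C * H] this bounds the new norm; with [N]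
    large and [A] small it shows that functionals of large rank barely exceed [H]. *)
Let phi_ub h al H N A j o : good h al -> (forall k, `|h k| <= H) ->
  (forall n, (N <= n)%N -> `|al n| <= A) -> 0 <= A ->
  `|phi (N, j, o) al| <= (1 + ep N) * (H + A / 2) + A.
Proof.
move=> hal hH alA A0; rewrite /phi.
have H0 : 0 <= H := le_trans (normr_ge0 _) (hH k0).
have HA : 0 <= H + A / 2 by rewrite addr_ge0// divr_ge0.
have U0 : 0 <= (1 + ep N) * (H + A / 2) + A.
  by rewrite addr_ge0// mulr_ge0// addr_ge0// ltW.
case: ifPn => [jN|_]; last by rewrite normr0.
set b := nth _ _ _; have bN : rapid d N b by apply: net_rapid; exact: mem_nth.
have pb : `|psum d N al b| <= H + A / 2.
  rewrite -[psum d N al b](subKr (h b)) (le_trans (ler_normB _ _))// lerD//.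
  exact: good_psum.
have e0 := ep0 N.
case: o => [[n sg]|].
  case: ifPn => [Nn|_]; last by rewrite normr0.
  rewrite (le_trans (ler_normD _ _))// lerD//; last first.
    by rewrite normrM normr_sign mul1r alA.
  rewrite normrM ger0_norm; last by rewrite addr_ge0// divr_ge0// ltW.
  by apply: ler_pM => //; [rewrite addr_ge0// divr_ge0// ltW|lra].
rewrite normrM ger0_norm; last by rewrite addr_ge0// ltW.
rewrite (@le_trans _ _ ((1 + ep N) * (H + A / 2)))//; last by rewrite lerDl.
by rewrite ler_wpM2l// addr_ge0// ltW.
Qed.

Let phi_ub_all h al H j : good h al -> (forall k, `|h k| <= H) ->
  `|phi j al| <= (2 + 2 * C) * H.
Proof.
move=> hal hH; have H0 : 0 <= H := le_trans (normr_ge0 _) (hH k0).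
have CH : 0 <= C * H by rewrite mulr_ge0// ltW.
case: j => [[N p] o].
have := phi_ub (N := N) p o hal hH (fun n _ => good_coord hal hH n) CH.
move=> /le_trans; apply.
have : (1 + ep N) * (H + C * H / 2) <= 2 * (H + C * H / 2).
  by rewrite ler_wpM2r ?addr_ge0 ?divr_ge0//; have := ep1 N; lra.
lra.
Qed.

(** With [A = e - (1 + ep N / 2) * be] bounding the tail, [H <= be + A / 2 + ep N / 8 * H].
    Multiplying by [1 + ep N / 2 <= 2] bounds the first two terms by [e], and [(1 + ep N / 2) * (1 -
    ep N / 8) >= 1 + ep N / 4]. *)
Let phi_lb h al e k : good h al -> (forall j, `|phi j al| <= e) ->
  (forall t, `|h t| <= `|h k|) -> exists N, (1 + ep N / 4) * `|h k| <= e.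
Proof.
move=> hal phie hk; set H := `|h k|.
have H0 : 0 <= H := normr_ge0 _.
have [V HV] := dV k.
have [N Nk] := tail_small (fun i => normr_ge0 (d i k)) HV (ltac:(lra) : 0 < 1 / 2 :> R).
have [b bN kb] := net_dense Nk.
have e0 := ep0 N; have e1 := ep1 N.
pose be := `|psum d N al b|.
have be_e n : (N <= n)%N -> (1 + ep N / 2) * be + `|al n| <= e.
  move=> Nn; have /(nthP k0)[p pN pb] := bN.
  (* The sign aligns the coordinate with the partial sum, so that their absolute values add up. *)
  have := phie (N, p, Some (n, (psum d N al b < 0) (+) (al n < 0))).
  rewrite /phi pN pb Nn; set s1 := _ < 0; set s2 := _ < 0.
  apply: le_trans; rewrite /be (normrEsign (psum d N al b)) (normrEsign (al n)).
  rewrite -/s1 -/s2.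
  rewrite [leRHS](_ : _ = `|(-1) ^+ s1 * ((1 + ep N / 2) * psum d N al b +
     (-1) ^+ (s1 (+) s2) * al n)|); last by rewrite normrM normr_sign mul1r.
  apply: le_trans (ler_norm _).
  rewrite mulrDr mulrA signr_addb mulrA mulrA -expr2 sqrr_sign mul1r.
  by rewrite le_eqVlt; apply/orP; left; apply/eqP; ring.
pose A := e - (1 + ep N / 2) * be.
have alA n : (N <= n)%N -> `|al n| <= A.
  by move=> /be_e; rewrite /A lerBrDl.
have A0 : 0 <= A := le_trans (normr_ge0 _) (alA N (leqnn N)).
have H1 := good_psum hal Nk alA.
have H2 : `|psum d N al k - psum d N al b| <= ep N / 8 * H.
  rewrite /psum -sumrB (le_trans (ler_norm_sum _ _ _))//.
  apply: (@le_trans _ _ (C * H * (ep N / (8 * C)))); last first.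
    rewrite le_eqVlt; apply/orP; left; apply/eqP; field; rewrite gt_eqF//.
  apply: (@le_trans _ _ (C * H * \sum_(n < N) `|d n k - d n b|)).
    rewrite mulr_sumr ler_sum// => n _; rewrite -mulrBr normrM ler_wpM2r//.
    exact: (good_coord hal hk).
  by rewrite ler_wpM2l// mulr_ge0 ?(ltW C0).
have H3 : H <= be + A / 2 + ep N / 8 * H.
  rewrite [leLHS](_ : H = `|(h k - psum d N al k) +
     (psum d N al k - psum d N al b) + psum d N al b|); last first.
    by rewrite addrA subrK subrK.
  rewrite (le_trans (ler_normD _ _))// -[leRHS]addrA [leRHS]addrC lerD2r.
  by rewrite (le_trans (ler_normD _ _))// lerD.
exists N.
have be0 : 0 <= be := normr_ge0 _.
have H4 : (1 + ep N / 2) * (H - ep N / 8 * H) <= (1 + ep N / 2) * (be + A / 2).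
  by rewrite ler_wpM2l; lra.
have H5 : (1 + ep N / 4) * H <= (1 + ep N / 2) * (H - ep N / 8 * H).
  rewrite -subr_ge0 [X in 0 <= X](_ : _ = ep N * H * (1 / 8 - ep N / 16)).
    by rewrite mulr_ge0 ?mulr_ge0 ?(ltW e0)//; lra.
  by field.
apply: (le_trans H5); apply: (le_trans H4).
have -> : e = (1 + ep N / 2) * be + A by rewrite /A addrC subrK.
rewrite mulrDr lerD2l.
have : (1 + ep N / 2) * A <= 2 * A by rewrite ler_wpM2r//; lra.
lra.
Qed.

Let good_max h al : good h al -> exists k, forall t, `|h t| <= `|h k|.
Proof.
move=> /good_continuous hc; apply: (compact_max k0 cK (v := fun k => `|h k|)).
by move=> t; apply: cvg_norm; exact: hc.
Qed.

Let phi_dom h al e : good h al -> (forall j, `|phi j al| <= e) ->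
  forall k, `|h k| <= e.
Proof.
move=> hal phie k; have [m hm] := good_max hal.
have [N HN] := phi_lb hal phie hm.
apply: le_trans (hm k) (le_trans _ HN).
by rewrite ler_peMl// lerDl divr_ge0// ltW.
Qed.

Let dom_dy : comb_dom (2 + 2 * C) d y.
Proof.
move=> N a e H j; rewrite comb_y; apply: phi_ub_all H; exact: good_gen.
Qed.

Let dom_yd : comb_dom 1 y d.
Proof.
move=> N a e H k; rewrite mul1r; apply: phi_dom (good_gen N a) _ k => j.
by rewrite -comb_y.
Qed.

Let dom_yc : comb_dom (1 + C) y (with_coords d).
Proof.
move=> N a e H s.
have e0 : 0 <= e := le_trans (normr_ge0 _) (H (0%N, 0%N, None)).
have Hd k : `|comb d N a k| <= e by have := dom_yd H k; rewrite mul1r.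
case: s => [k|i].
  rewrite -[comb _ _ _ _]/(comb d N a k) (le_trans (Hd k))// mulrDl mul1r lerDl.
  by rewrite mulr_ge0// ltW.
rewrite -[comb _ _ _ _]/(comb unit_seq N a i) (le_trans (dom_coords Hd i))//.
by rewrite mulrDl mul1r lerDr.
Qed.

Let y_bounded i : exists M, forall j, `|y i j| <= M.
Proof.
pose a n : R := unit_seq i n.
have [m hm] := good_max (good_gen i.+1 a).
exists ((2 + 2 * C) * `|comb d i.+1 a m|) => j.
have := dom_dy hm j; rewrite comb_y; congr (_ <= _); congr (`|phi _ _|).
apply/funext => n; rewrite /a /unit_seq; case: ltnP => //.
by case: eqP => // ->; rewrite ltnn.
Qed.

Let d_bounded i : exists M, forall k, `|d i k| <= M.
Proof.
have [] := compact_max k0 cK (v := fun k => `|d i k|).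
  by move=> t; apply: cvg_norm; exact: dc.
by move=> b Hb; exists `|d i b|.
Qed.

(** Each functional reads finitely many coordinates, so it passes to uniform limits of coordinate
    sequences. [L] may depend on [j]. *)
Let phi_cont j : exists2 L, 0 <= L & forall h e, (forall i, `|h i| <= e) ->
  `|phi j h| <= L * e.
Proof.
have pL N k : exists2 L, 0 <= L & forall h e, (forall i, `|h i| <= e) ->
    `|psum d N h k| <= L * e.
  exists (\sum_(n < N) `|d n k|); first by rewrite sumr_ge0.
  move=> h e he; rewrite (le_trans (ler_norm_sum _ _ _))// mulr_suml.
  by rewrite ler_sum// => i _; rewrite normrM mulrC ler_wpM2l.
case: j => [[N p] o]; have [L L0 HL] := pL N (nth k0 (net N) p).
exists (2 * L + 1); first by rewrite addr_ge0// mulr_ge0.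
have e0 := ep0 N; have e1 := ep1 N.
move=> h e he; rewrite /phi; have h0 : 0 <= e := le_trans (normr_ge0 _) (he 0%N).
have U0 : 0 <= (2 * L + 1) * e by rewrite mulr_ge0// addr_ge0// mulr_ge0.
case: ifPn => _; last by rewrite normr0.
have w (c : R) : 0 <= c <= 2 -> `|c * psum d N h (nth k0 (net N) p)| <= 2 * L * e.
  by move=> /andP[c0 c2]; rewrite normrM ger0_norm// -mulrA ler_pM// HL.
have UE : (2 * L + 1) * e = 2 * L * e + e by ring.
case: o => [[n sg]|].
  case: ifPn => _; last by rewrite normr0.
  rewrite UE.
  rewrite (le_trans (ler_normD _ _))// lerD// ?w//; first by apply/andP; split; lra.
  by rewrite normrM normr_sign mul1r.
by rewrite UE (le_trans (w _ _))// ?lerDl//; apply/andP; split; lra.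
Qed.

Let span_good (x : spanT y) : exists h al, good h al /\ forall j, x j = phi j al.
Proof.
have C1 : 0 < 1 + C by rewrite addr_gt0.
have [z xz] := joinf_ex C1 dom_yc (span_closed x).
exists (fun k => z (inl k)), (fun i => z (inr i)); split.
  have := closed_span_comp (fun s => inr s) xz; congr closed_span.
  by apply/funext; case.
move=> j; apply/eqP; rewrite -subr_eq0 -normr_le0; apply/ler_addgt0Pl => e e0.
have [L L0 HL] := phi_cont j; rewrite addr0.
have L1 : 0 < 1 + L by rewrite ltr_pwDl.
have [N [a [H1 H2]]] := (closed_span_joinf _ _ _ _).1 xz _ (divr_gt0 e0 L1).
pose al' i := if (i < N)%N then a i else 0.
have -> : x j - phi j (fun i => z (inr i)) = (x j - comb y N a j) +
   phi j (fun i => -1 * z (inr i) + al' i).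
  by rewrite phi_lin comb_y -/al'; ring.
have -> : e = e / (1 + L) + L * (e / (1 + L)) by field; rewrite gt_eqF.
rewrite (le_trans (ler_normD _ _))// lerD//; apply: HL => i.
have := H2 (inr i); rewrite -[comb _ _ _ _]/(comb unit_seq N a i) comb_unit_seq.
by rewrite -/(al' i) distrC mulN1r addrC.
Qed.

(** Outside [F], either the rank is large and the value is near [H], which is below the norm; or the
    functional is zero; or the rank is below [N0] and the coordinate is so late that the value is
    close to [(1 + ep N / 2) * be], strictly below the companion [(1 + ep N) * be]. *)
Let y_gap : coord_gap y.
Proof.
move=> x x0; have [h [al [hal xE]]] := span_good x.
set n := `|x|; have n0 : 0 < n by rewrite normr_gt0.
have phin j : `|phi j al| <= n by rewrite -xE; exact: span_ub.
have [m hm] := good_max hal; pose H := `|h m|.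
have H0 : 0 <= H := normr_ge0 _.
have Hn : H < n.
  have [N HN] := phi_lb hal phin hm; rewrite -/H in HN.
  have [H00|H00] := eqVneq H 0; first by rewrite H00.
  apply: lt_le_trans HN; rewrite ltr_pMl ?ltrDl ?divr_gt0//.
  by rewrite lt_neqAle eq_sym H00.
pose g := n - H; have g0 : 0 < g by rewrite subr_gt0.
(* Tails below [g / 8] and [ep N * H <= g / 4] together keep the bound of [phi_ub] below
   [H + g / 2 = n - g / 2]. *)
have [N1 HN1] := good_c0 hal (ltac:(lra) : 0 < g / 8).
have H1 : 0 < H + 1 by rewrite ltr_wpDl.
have gH0 : 0 < g / 4 / (H + 1) by rewrite !divr_gt0.
have [N2 HN2] := ep_small gH0.
pose N0 := maxn N1 N2.
have nep0 : 0 < n * ep N0 / 8 by rewrite divr_gt0// mulr_gt0.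
have [n1 Hn1] := good_c0 hal nep0.
pose P0 := \sum_(N < N0) size (net N).
pose os := None :: [seq Some (i, true) | i <- iota 0 n1] ++
  [seq Some (i, false) | i <- iota 0 n1].
exists [seq (Np, o) | Np <- [seq (N, p) | N <- iota 0 N0, p <- iota 0 P0], o <- os].
exists (Order.min (g / 2) (n * ep N0 / 8)); split.
  by rewrite lt_min nep0 divr_gt0.
set dl := Order.min _ _.
have dl1 : dl <= g / 2 by rewrite ge_min lexx.
have dl2 : dl <= n * ep N0 / 8 by rewrite ge_min lexx orbT.
have nd : 0 <= n - dl by rewrite subr_ge0 (le_trans dl1)//; rewrite /g; lra.
move=> [[N p] o] jF; rewrite -/n xE.
have [NN0|N0N] := ltnP N N0; last first.
  have Nn1 : (N1 <= N)%N := leq_trans (leq_maxl _ _) N0N.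
  have g8 : 0 <= g / 8 by rewrite divr_ge0// ltW.
  apply: le_trans (phi_ub p o hal hm
    (fun i Ni => HN1 i (leq_trans Nn1 Ni)) g8) _.
  have e1 := ep1 N; rewrite -/H.
  have eH : ep N * H <= g / 4.
    have := HN2 N (leq_trans (leq_maxr _ _) N0N).
    rewrite ler_pdivlMr//; apply: le_trans.
    by rewrite ler_wpM2l ?(ltW (ep0 N))// lerDl.
  have : ep N * (g / 8 / 2) <= g / 8 / 2 by rewrite ler_piMl// divr_ge0.
  move: dl1; rewrite /g; rewrite /g in eH *; lra.
have [pN|Np] := ltnP p (size (net N)); last first.
  by rewrite /phi ltnNge Np /= normr0.
have pP0 : (p < P0)%N.
  by rewrite (leq_trans pN)// /P0 (bigD1 (Ordinal NN0))//= leq_addr.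
have oos : o \notin os.
  apply: contra jF => oos; apply/allpairsP; exists ((N, p), o); split=> //=.
  by apply/allpairsP; exists (N, p); rewrite !mem_iota.
case: o oos {jF} => [[i sg]|//] oos.
have n1i : (n1 <= i)%N.
  rewrite leqNgt; apply: contra oos => in1.
  rewrite inE /= mem_cat; case: sg; apply/orP; [left|right];
    by apply: map_f; rewrite mem_iota.
have := phin (N, p, None); rewrite /phi pN.
set b := nth _ _ _ => Hb; case: ifPn => [Ni|_]; last by rewrite normr0.
have e0 := ep0 N; have e1 := ep1 N; have eN := ep_mono (ltnW NN0).
have pe : 0 <= 1 + ep N by rewrite addr_ge0// ltW.
rewrite normrM (ger0_norm pe) in Hb.
rewrite (le_trans (ler_normD _ _))// !normrM normr_sign mul1r.
rewrite (@ger0_norm _ (1 + ep N / 2)); last by rewrite addr_ge0// divr_ge0// ltW.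
have Hi := Hn1 i n1i; set be := `|psum d N al b| in Hb *.
have be0 : 0 <= be := normr_ge0 _.
(* The loss [ep N / 4] relative to the companion functional beats the coordinate, at most
   [n * ep N0 / 8], because [ep N0 <= ep N]. *)
have H3 : (1 + ep N / 2) * be <= (1 - ep N / 4) * ((1 + ep N) * be).
  rewrite mulrA ler_wpM2r//.
  have : ep N * ep N <= ep N * 1 by rewrite ler_wpM2l// ltW.
  lra.
have H2 : (1 - ep N / 4) * ((1 + ep N) * be) <= (1 - ep N / 4) * n.
  by rewrite ler_wpM2l//; lra.
have H4 : n * ep N0 <= n * ep N by rewrite ler_wpM2l// ltW.
lra.
Qed.

Lemma renorm_polyhedral : exists X : completeNormedModType R,
  separable_space X /\ polyhedral X /\ isomorphic_to (closed_span d) X.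
Proof.
exists (spanC y); split; first exact: span_separable y_bounded.
split; last first.
  apply: (comb_dom_isomorphic _ ltr01 dom_dy dom_yd d_bounded y_bounded).
  by rewrite addr_gt0// mulr_gt0.
split; last by move=> s; exact: coord_gap_polyhedral y_gap.
apply: (lspan_proper y_bounded) => N a Ha i iN.
have Hy j : `|comb y N a j| <= 0 by rewrite Ha normr0.
have Hd k : `|comb d N a k| <= 0 by have := dom_yd Hy k; rewrite mulr0.
by apply/eqP; rewrite -normr_le0 -[leRHS](mulr0 C); exact: dC Hd _ iN.
Qed.

End renorming.

Lemma block_comb_continuous {R : realType} {K : topologicalType}
    (fs : nat -> K -> R) lo c n :
  (forall n, continuous (fs n)) -> continuous (block_comb fs lo c n).
Proof.
move=> fc; rewrite /block_comb; elim: (index_iota _ _) => [|i r IH].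
  under [X in continuous X]funext do rewrite big_nil.
  by move=> x; exact: cvg_cst.
under [X in continuous X]funext do rewrite big_cons.
move=> x; apply: cvgD; last exact: IH.
by apply: cvgM; [exact: cvg_cst|exact: fc].
Qed.

Lemma diffs_continuous {R : realType} {K : topologicalType} (g : nat -> K -> R) n :
  (forall n, continuous (g n)) -> continuous (diffs g n).
Proof.
by move=> gc; case: n => [|n] x; [exact: gc|apply: cvgB; exact: gc].
Qed.

Lemma diffs_variation {R : realType} {K : Type} (g : nat -> K -> R) s k V :
  (forall n, (s n < s n.+1)%N) ->
  (forall m, \sum_(n < m) `|g n.+1 k - g n k| <= V) ->
  forall m, \sum_(n < m) `|diffs (fun n => g (s n)) n k| <= `|g (s 0%N) k| + V.
Proof.
move=> sS gV [|m].
  by rewrite big_ord0 addr_ge0//; have := gV 0%N; rewrite big_ord0.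
rewrite big_ord_recl /= lerD2l.
exact: le_trans (subseq_variation (fun n => g n k) m sS) (gV _).
Qed.

Theorem theorem1p7 (R : realType) (K : metricType R)
  (Kcompact : compact [set: K]) (f : K -> R)
  (fDSC : DSC f) (fnotC : ~ continuous f) :
  forall fs : nat -> K -> R,
    (forall n, continuous (fs n)) ->
    (exists M : R, forall n k, `|fs n k| <= M) ->
    (forall k, (fun n => fs n k) @ \oo --> f k) ->
    exists gs : nat -> K -> R,
      convex_block_seq fs gs /\
      exists X : completeNormedModType R,
        separable_space X /\ polyhedral X /\ isomorphic_to (closed_span gs) X.
Proof.
move=> fs fsc [M fsM] fsf.
(* Discontinuity also supplies a point of [K]. *)
have [k0 _] := discontinuity_gap fnotC.
have [lo [c [lS [c0 [c1 cV]]]]] := block_variation Kcompact fDSC fsc fsM fsf.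
pose g := block_comb fs lo c.
have gc n : continuous (g n) by exact: block_comb_continuous.
have gf k : (fun n => g n k) @ \oo --> f k by exact: block_comb_cvg.
have [s [C [sS [C0 sC]]]] := diffs_dominate gc gf fnotC.
exists (fun n => g (s n)); split.
  exists (fun n => index_iota (lo (s n)) (lo (s n).+1)), c.
  split=> [n|].
    by rewrite -size_eq0 size_iota subn_eq0 -ltnNge.
  split=> [n|]; first exact: iota_uniq.
  split=> [n i j|//].
  rewrite !mem_index_iota => /andP[_ i1] /andP[j1 _].
  exact: leq_trans i1 (leq_trans (increasing_mono lS (sS n)) j1).
rewrite -closed_span_diffs; apply: (renorm_polyhedral k0 Kcompact _ _ C0 sC).
  by move=> n; exact: diffs_continuous.
move=> k; have [V HV] := cV k; exists (`|g (s 0%N) k| + V).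
exact: diffs_variation.
Qed.
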